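(* Let $S$ be a Kato surface of intermediate type, let $D$ be its maximal reduced divisor of rational curves, assume $0<\mu<2$, and fix $M>0$. On the open surface $S\setminus D$, consider the family of Hermitian metrics $$\Omega_t^M=A(t)\,\omega_{\rm tr}+e^{-t}s^\mu\sqrt{-1}\,\Theta\wedge\overline\Theta,\qquad A(t)=2-\mu+e^{-t}\bigl(M-(2-\mu)\bigr),\quad t\ge0,$$ and let $d_t$ be the induced distance on $S\setminus D$. Let $K=K_{s_0,R}$ be a compact Green block ($s_0>0$, $R>0$). Then $$(K,d_t|_{K\times K})\longrightarrow(S^1_G,d_G)$$ in the Gromov--Hausdorff sense as $t\to+\infty$. Thus, along the exhaustion by compact Green blocks, the explicit normalised Chern--Ricci solution $\Omega_t^M$ collapses $S\setminus D$ to the Green circle.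
   Context: Convention. The Riemannian metric associated with a Hermitian metric $\omega$ is $g_\omega(u,v)=\omega(u,Jv)$ (so $\sqrt{-1}\,dz\wedge d\bar z$ corresponds to $2|dz|^2$). Intermediate surfaces. A Kato surface is a minimal compact complex surface of class VII with $b_2>0$ containing a global spherical shell; it is of intermediate type if its rational curves consist of a single cycle together with at least one tree of rational curves meeting the cycle. Let $r=\operatorname{ind}(S)$ be its index. By Dloussky--Oeljeklaus--Toma and Oeljeklaus--Toma, the universal cover of $S\setminus D$ is $X=\mathbb H_\ell\times\mathbb C$, $\mathbb H_\ell=\{w\in\mathbb C:\Re w<0\}$, with coordinates $(w,z)$, and the deck group $\Gamma$ is generated by $$T(w,z)=(w+2\pi\sqrt{-1},z),\qquad G(w,z)=(kw,\lambda z+h(w)),$$ and, if $r>1$, also $\varphi(w,z)=(w-\tfrac{2\pi\sqrt{-1}}{r},\xi z)$. Here $k\ge2$ is an integer, $\lambda\in\mathbb C^*$, $h(w)=Q(e^{-w})$ for a polynomial $Q$, and $\xi=e^{2\pi\sqrt{-1}\sigma_0/r}$ with $\sigma_0$ the largest exponent occurring in $Q$. Every $\gamma\in\Gamma$ has the form $\gamma(w,z)=(a_\gamma w+b_\gamma,\lambda_\gamma z+h_\gamma(w))$ with $a_\gamma>0$, $\lambda_\gamma\in\mathbb C^*$, $h_\gamma$ holomorphic. Notation. $\mu:=-\frac{2\log|\lambda|}{\log k}$; $s:=-\Re w>0$, $\theta:=\Im w$; $\omega_{\rm tr}:=\sqrt{-1}\,\partial\overline\partial(-\log s)=\frac{\sqrt{-1}}{4s^2}dw\wedge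 d\bar w$. The form $\Theta$. Fix $\chi\in\mathcal C^\infty(X)$, $\chi\ge0$, with $\{\chi\circ\gamma\}_{\gamma\in\Gamma}$ locally finite and $\sum_{\gamma\in\Gamma}\chi(\gamma p)=1$ for all $p\in X$. With $g_0=|dw|^2+|dz|^2$, let $g:=\sum_{\gamma\in\Gamma}\chi(\gamma p)\,\gamma^*g_0$, a $\Gamma$-invariant Hermitian metric, and let $H\subset T_X^{1,0}$ be the $g$-orthogonal complement of $\mathbb C\,\partial_z$. Then $\Theta=dz+B\,dw$ is the unique smooth $(1,0)$-form with $\Theta(\partial_z)=1$ and $\Theta|_H=0$; it satisfies $\gamma^*\Theta=\lambda_\gamma\Theta$ for all $\gamma\in\Gamma$, and $\Omega_t^M$ is $\Gamma$-invariant, so descends to $S\setminus D$; it solves $\partial_t\Omega_t^M=-\operatorname{Ric}(\Omega_t^M)-\Omega_t^M$. Green circle and blocks. $\ell_G:=\frac12\log k$, $S^1_G:=\mathbb R/\ell_G\mathbb Z$ with $d_G$ the length distance induced by $2(2-\mu)\,d\rho^2$, $\rho$ the coordinate on $\mathbb R$. Let $q:X\to S\setminus D$ be the quotient map; the compact Green block is $K_{s_0,R}:=q(\{s_0\le s\le ks_0,\ 0\le\theta\le2\pi,\ |z|\le R\})$. For fixed $s_0$ these exhaust $S\setminus D$ as $R\to+\infty$. $d_t|_{K\times K}$ is the ambient distance of $S\setminus D$ restricted to $K\times K$. *)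

(* Defs.v *)
From HB Require Import structures.
From mathcomp Require Import all_boot all_order all_algebra.
From mathcomp Require Import all_classical all_reals all_analysis.
From mathcomp Require Import complex.
Set Implicit Arguments.
Unset Strict Implicit.
Unset Printing Implicit Defensive.
Import Order.TTheory GRing.Theory Num.Theory numFieldNormedType.Exports.
Local Open Scope classical_set_scope.
Local Open Scope ring_scope.
Local Open Scope complex_scope.

Definition C2 (R : realType) : normedModType R[i] := (R[i]^o * R[i]^o)%type.

Definition cabs (R : realType) (z : R[i]) : R := Normc.normc z.

Definition cexp (R : realType) (z : R[i]) : R[i] :=
  (expR (complex.Re z) * cos (complex.Im z)) +i*
  (expR (complex.Re z) * sin (complex.Im z)).

Definition det2 (R : realType) (u v : C2 R) : R[i] := u.1 * v.2 - u.2 * v.1.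

Record chart (R : realType) (S : topologicalType) := Chart {
  cdom : set S;
  cmap : S -> C2 R;
  cinv : C2 R -> S }.

Definition is_chart (R : realType) (S : topologicalType) (c : chart R S) :=
  [/\ open (cdom c), open (cmap c @` cdom c),
      forall x, cdom c x -> cinv c (cmap c x) = x,
      forall x, cdom c x -> {for x, continuous (cmap c)}
    & forall y, (cmap c @` cdom c) y -> {for y, continuous (cinv c)}].

Definition transition (R : realType) (S : topologicalType) (c c' : chart R S)
  : C2 R -> C2 R := cmap c' \o cinv c.

(* [differentiable] is over the field R[i], that is, complex
   differentiability. *)
Definition complex_atlas (R : realType) (S : topologicalType)
    (At : set (chart R S)) :=
  [/\ forall c, At c -> is_chart c,
      forall x : S, exists2 c, At c & cdom c x
    & forall c c', At c -> At c' -> forall x, cdom c x -> cdom c' x ->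
        differentiable (transition c c') (cmap c x)].

Definition compact_complex_surface (R : realType) (S : topologicalType)
    (At : set (chart R S)) :=
  [/\ complex_atlas At, hausdorff_space S, compact [set: S],
      connected [set: S] & [set: S] !=set0].

Definition holo_map (R : realType) (S : topologicalType) (At : set (chart R S))
    (V : normedModType R[i]) (U : set V) (f : V -> S) :=
  forall p, U p -> {for p, continuous f} /\
    forall c, At c -> cdom c (f p) -> differentiable (cmap c \o f) p.

(* The projective line; None is the point at infinity. *)
Definition P1 (R : realType) := option R[i].

(* Holomorphic parametrisation of a neighbourhood of x, centred at x. *)
Definition p1loc (R : realType) (x : P1 R) (u : R[i]^o) : P1 R :=
  if x is Some a then Some (a + u) else if u == 0 then None else Some u^-1.

Definition p1zero (R : realType) : P1 R := Some 0.
Definition p1infty (R : realType) : P1 R := None.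

Definition holo_P1 (R : realType) (S : topologicalType) (At : set (chart R S))
    (f : P1 R -> S) :=
  holo_map At setT (f \o p1loc (p1zero R)) /\
  holo_map At setT (f \o p1loc (p1infty R)).

Definition rational_curve (R : realType) (S : topologicalType)
    (At : set (chart R S)) (C : set S) :=
  exists f : P1 R -> S,
    [/\ holo_P1 At f, exists x y, f x <> f y & C = range f].

Definition rational_divisor (R : realType) (S : topologicalType)
    (At : set (chart R S)) : set S :=
  [set x | exists2 C, rational_curve At C & C x].

Definition velocity (R : realType) (S : topologicalType) (c : chart R S)
    (f : P1 R -> S) (x : P1 R) : C2 R :=
  'D_(1 : R[i]^o) (cmap c \o f \o p1loc x) 0.

Definition immersed (R : realType) (S : topologicalType) (At : set (chart R S))
    (f : P1 R -> S) :=
  forall x c, At c -> cdom c (f x) -> velocity c f x != 0.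

(* Meaningful when f x = g y. *)
Definition transverse (R : realType) (S : topologicalType)
    (At : set (chart R S)) (f : P1 R -> S) (x : P1 R) (g : P1 R -> S)
    (y : P1 R) :=
  forall c, At c -> cdom c (f x) ->
    det2 (velocity c f x) (velocity c g y) != 0.

(* The curves E_0, ..., E_(n-1) are parametrised so that the point at infinity
   of each one is glued to the zero of the next one modulo n, with no other
   coincidences.  For n = 1 this is a rational curve with one node; for n = 2,
   two smooth curves meeting in two points. *)
Definition curve_cycle (R : realType) (S : topologicalType)
    (At : set (chart R S)) (n : nat) (E : nat -> P1 R -> S) :=
  (forall i j x y, (i < n)%N -> (j < n)%N ->
     E i x = E j y <->
     [\/ i = j /\ x = y,
         [/\ j = (i.+1 %% n)%N, x = p1infty R & y = p1zero R]
       | [/\ i = (j.+1 %% n)%N, x = p1zero R & y = p1infty R]]) /\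
  (forall i, (i < n)%N ->
     transverse At (E i) (p1infty R) (E (i.+1 %% n)%N) (p1zero R)).

(* The smooth curves E_n, ..., E_(n+m-1) form trees growing on the union of
   E_0, ..., E_(n-1): each of them meets its predecessors in a single point,
   lying on a single branch of them, and transversally.  The dual graph is
   therefore the one of E_0, ..., E_(n-1) with m vertices attached one at a
   time, each by a single edge. *)
Definition curve_trees (R : realType) (S : topologicalType)
    (At : set (chart R S)) (n m : nat) (E : nat -> P1 R -> S) :=
  forall j, (n <= j < n + m)%N ->
  [/\ injective (E j),
      exists! a : nat * (P1 R * P1 R),
        (a.1 < j)%N /\ E a.1 a.2.1 = E j a.2.2
    & forall i x y, (i < j)%N -> E i x = E j y ->
        transverse At (E i) x (E j) y].

Definition intermediate_type (R : realType) (S : topologicalType)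
    (At : set (chart R S)) :=
  exists n m (E : nat -> P1 R -> S),
    [/\ (0 < n)%N /\ (0 < m)%N,
        forall i, (i < n + m)%N -> holo_P1 At (E i) /\ immersed At (E i),
        curve_cycle At n E,
        curve_trees At n m E
      & forall C, rational_curve At C ->
          exists2 i, (i < n + m)%N & C = range (E i)].

(* An open embedding of a neighbourhood of the exceptional curve in the blow-up
   of C^2 at the origin.  In its two standard charts the blow-down map reads
   (u, v) |-> (u, u v) and (u, v) |-> (u v, v). *)
Definition exceptional_curve (R : realType) (S : topologicalType)
    (At : set (chart R S)) :=
  exists (e : R) (f0 f1 : C2 R -> S),
    let U0 := [set p : C2 R | cabs p.1 ^+ 2 + cabs (p.1 * p.2) ^+ 2 < e] in
    let U1 := [set p : C2 R | cabs (p.1 * p.2) ^+ 2 + cabs p.2 ^+ 2 < e] in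
    [/\ 0 < e, holo_map At U0 f0 /\ holo_map At U1 f1,
        {in U0 &, injective f0} /\ {in U1 &, injective f1}
      & forall p p', U0 p -> U1 p' ->
          f0 p = f1 p' <-> p.2 != 0 /\ p' = (p.2^-1, p.1 * p.2)].

Definition minimal (R : realType) (S : topologicalType)
    (At : set (chart R S)) := ~ exceptional_curve At.

Definition global_spherical_shell (R : realType) (S : topologicalType)
    (At : set (chart R S)) :=
  exists (e : R) (f : C2 R -> S),
    let W := [set p : C2 R |
      1 - e < cabs p.1 ^+ 2 + cabs p.2 ^+ 2 < 1 + e] in
    [/\ 0 < e < 1, holo_map At W f, {in W &, injective f}
      & connected (~` (f @` W))].

Definition simplex (R : realType) (n : nat) : set 'rV[R]_n.+1 :=
  [set x | (forall i, 0 <= x 0 i) /\ \sum_i x 0 i = 1].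

(* A formal rational combination of singular simplices; a singular simplex is
   given by a map on the whole space, of which only the restriction to the
   standard simplex matters (see chain_coef). *)
Definition chain (R : realType) (S : topologicalType) (n : nat) :=
  seq (rat * ('rV[R]_n.+1 -> S)).

Definition is_chain (R : realType) (S : topologicalType) (n : nat)
    (z : chain R S n) : bool :=
  all (fun a => `[< {within @simplex R n, continuous a.2} >]) z.

Definition chain_coef (R : realType) (S : topologicalType) (n : nat)
    (z : chain R S n) (f : 'rV[R]_n.+1 -> S) : rat :=
  \sum_(a <- z | `[< {in @simplex R n, a.2 =1 f} >]) a.1.

Definition chain_eq (R : realType) (S : topologicalType) (n : nat)
    (z z' : chain R S n) :=
  forall f, chain_coef z f = chain_coef z' f.

Definition chain_scale (R : realType) (S : topologicalType) (n : nat)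
    (b : rat) (z : chain R S n) : chain R S n :=
  [seq (b * a.1, a.2) | a <- z].

Definition face (R : realType) (n : nat) (i : 'I_n.+2) (x : 'rV[R]_n.+1)
  : 'rV[R]_n.+2 :=
  \row_j (if unlift i j is Some j' then x 0 j' else 0).

Definition boundary (R : realType) (S : topologicalType) (n : nat)
    (z : chain R S n.+1) : chain R S n :=
  flatten [seq [seq ((-1) ^+ (i : nat) * a.1, a.2 \o @face R n i)
                  | i : 'I_n.+2 <- enum 'I_n.+2] | a <- z].

(* In positive degree. *)
Definition is_cycle (R : realType) (S : topologicalType) (n : nat)
    (z : chain R S n.+1) :=
  is_chain z /\ chain_eq (boundary z) [::].

Definition is_boundary (R : realType) (S : topologicalType) (n : nat)
    (z : chain R S n) :=
  exists w : chain R S n.+1, is_chain w /\ chain_eq (boundary w) z.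

(* The Betti number of S in degree n.+1 is b: there are cycles e_i, i < b,
   whose classes form a basis of the homology. *)
Definition betti_succ (R : realType) (S : topologicalType) (n b : nat) :=
  exists e : 'I_b -> chain R S n.+1,
    (forall i, is_cycle (e i)) /\
    (forall z, is_cycle z -> exists! a : {ffun 'I_b -> rat},
       is_boundary (z ++ flatten [seq chain_scale (- a i) (e i)
                                    | i <- enum 'I_b])).

Definition jacobian (R : realType) (f : C2 R -> C2 R) (p : C2 R) : R[i] :=
  det2 ('D_((1, 0) : C2 R) f p) ('D_((0, 1) : C2 R) f p).

(* Holomorphic sections of the m-th power of the canonical bundle, written
   s_c (dx /\ dy)^m in each chart c. *)
Definition pluricanonical (R : realType) (S : topologicalType)
    (At : set (chart R S)) (m : nat) (s : chart R S -> C2 R -> R[i]^o) :=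
  (forall c, At c -> forall x, cdom c x -> differentiable (s c) (cmap c x)) /\
  (forall c c', At c -> At c' -> forall x, cdom c x -> cdom c' x ->
     s c (cmap c x) =
     s c' (cmap c' x) * jacobian (transition c c') (cmap c x) ^+ m).

Definition kodaira_dim_minus_infty (R : realType) (S : topologicalType)
    (At : set (chart R S)) :=
  forall m s, (0 < m)%N -> pluricanonical At m s ->
    forall c, At c -> forall x, cdom c x -> s c (cmap c x) = 0.

Definition class_VII (R : realType) (S : topologicalType)
    (At : set (chart R S)) :=
  betti_succ R S 0 1 /\ kodaira_dim_minus_infty At.

Definition kato_surface (R : realType) (S : topologicalType)
    (At : set (chart R S)) :=
  [/\ compact_complex_surface At, minimal At, class_VII At,
      exists2 b, (0 < b)%N & betti_succ R S 1 b
    & global_spherical_shell At].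

(* Points of C2 are (w, z). *)
Definition Xcov (R : realType) : set (C2 R) :=
  [set p | complex.Re p.1 < 0].

Definition s_of (R : realType) (p : C2 R) : R := - complex.Re p.1.

Definition theta_of (R : realType) (p : C2 R) : R := complex.Im p.1.

Definition hfun (R : realType) (Q : {poly R[i]}) (w : R[i]) : R[i] :=
  Q.[cexp (- w)].

Definition deck_T (R : realType) (p : C2 R) : C2 R :=
  (p.1 + 0 +i* (2 * pi), p.2).

Definition deck_G (R : realType) (k : nat) (lam : R[i]) (Q : {poly R[i]})
    (p : C2 R) : C2 R :=
  (k%:R * p.1, lam * p.2 + hfun Q p.1).

(* (size Q).-1 is the largest exponent occurring in Q. *)
Definition deck_xi (R : realType) (r : nat) (Q : {poly R[i]}) : R[i] :=
  cexp (0 +i* (2 * pi * (size Q).-1%:R / r%:R)).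

Definition deck_phi (R : realType) (r : nat) (Q : {poly R[i]}) (p : C2 R)
  : C2 R :=
  (p.1 - 0 +i* (2 * pi / r%:R), deck_xi r Q * p.2).

Definition deck_gen (R : realType) (k r : nat) (lam : R[i]) (Q : {poly R[i]})
  : set (C2 R -> C2 R) :=
  [set g | [\/ g = @deck_T R, g = deck_G k lam Q
             | (1 < r)%N /\ g = deck_phi r Q]].

(* The subgroup generated by a set of bijections.  The generators above are
   entire automorphisms of C2 preserving Xcov, so an element of the group is
   determined by its restriction to Xcov. *)
Inductive generated (T : Type) (gen : set (T -> T)) : set (T -> T) :=
| generated_id : generated gen id
| generated_gen g : gen g -> generated gen g
| generated_comp g g' : generated gen g -> generated gen g' ->
    generated gen (g \o g')
| generated_inv g g' : generated gen g -> cancel g g' -> cancel g' g ->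
    generated gen g'.

Definition deck_group (R : realType) (k r : nat) (lam : R[i])
    (Q : {poly R[i]}) : set (C2 R -> C2 R) :=
  generated (deck_gen k r lam Q).

(* q restricted to Xcov is a holomorphic covering of ~` D, whose group of deck
   transformations is Gam; as Xcov is convex, it is the universal cover. *)
Definition uniformizes (R : realType) (S : topologicalType)
    (At : set (chart R S)) (D : set S) (Gam : set (C2 R -> C2 R))
    (q : C2 R -> S) :=
  [/\ holo_map At (@Xcov R) q,
      q @` (@Xcov R) = ~` D,
      forall U, open U -> U `<=` @Xcov R -> open (q @` U),
      forall p p', Xcov p -> Xcov p' ->
        q p = q p' <-> exists2 g, Gam g & p' = g p
    & forall p, Xcov p -> exists U, [/\ open U, U p, U `<=` @Xcov R
        & forall g x, Gam g -> U x -> U (g x) -> g = id]].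

Fixpoint smooth_upto (R : realType) (n : nat) (U : set (C2 R))
    (f : C2 R -> R) : Prop :=
  (forall p, U p -> {for p, continuous f}) /\
  if n is n'.+1 then
    forall v : C2 R,
      let line p := fun h : R^o => f (p + h%:C *: v) : R^o in
      (forall p, U p -> derivable (line p) 0 1) /\
      smooth_upto n' U (fun p => derive1 (line p) 0)
  else True.

Definition smooth (R : realType) (U : set (C2 R)) (f : C2 R -> R) :=
  forall n, smooth_upto n U f.

Definition invariant_partition (R : realType) (Gam : set (C2 R -> C2 R))
    (chi : C2 R -> R) :=
  [/\ smooth (@Xcov R) chi,
      forall p, Xcov p -> 0 <= chi p,
      forall p, Xcov p -> exists2 U, nbhs p U &
        finite_set [set g | Gam g /\
          exists2 x, (U `&` @Xcov R) x & chi (g x) != 0]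
    & forall p, Xcov p -> \sum_(g \in Gam) chi (g p) = 1].

(* The Hermitian form of |dw|^2 + |dz|^2. *)
Definition hdot (R : realType) (u v : C2 R) : R[i] :=
  u.1 * (v.1)^*%C + u.2 * (v.2)^*%C.

Definition averaged_metric (R : realType) (Gam : set (C2 R -> C2 R))
    (chi : C2 R -> R) (p u v : C2 R) : R[i] :=
  \sum_(g \in Gam) (chi (g p))%:C * hdot ('D_u g p) ('D_v g p).

Definition dz_dir (R : realType) : C2 R := (0, 1).

(* A (1,0)-form is a complex-linear form at each point.  The two conditions
   determine it on Xcov. *)
Definition is_Theta (R : realType) (Gam : set (C2 R -> C2 R))
    (chi : C2 R -> R) (Theta : C2 R -> {linear C2 R -> R[i]^o}) :=
  forall p, Xcov p ->
    Theta p (dz_dir R) = 1 /\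
    forall u, averaged_metric Gam chi p u (dz_dir R) = 0 -> Theta p u = 0.

Definition mu_of (R : realType) (k : nat) (lam : R[i]) : R :=
  - (2 * ln (cabs lam) / ln k%:R).

(* sqrt(-1) a /\ conj(a) *)
Definition i_wedge_conj (R : realType) (a : C2 R -> R[i]) (u v : C2 R)
  : R[i] :=
  'i%C * (a u * (a v)^*%C - a v * (a u)^*%C).

Definition omega_tr (R : realType) (p u v : C2 R) : R[i] :=
  ((4 * s_of p ^+ 2)^-1)%:C * i_wedge_conj fst u v.

Definition A_of (R : realType) (mu M t : R) : R :=
  2 - mu + expR (- t) * (M - (2 - mu)).

Definition Omega (R : realType) (mu M : R)
    (Theta : C2 R -> {linear C2 R -> R[i]^o}) (t : R) (p u v : C2 R) : R[i] :=
  (A_of mu M t)%:C * omega_tr p u v +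
  (expR (- t) * s_of p `^ mu)%:C * i_wedge_conj (Theta p) u v.

(* The norm of the Riemannian metric g(u, v) = omega(u, J v). *)
Definition riem_norm (R : realType) (omega : C2 R -> C2 R -> C2 R -> R[i])
    (p u : C2 R) : R :=
  Num.sqrt (complex.Re (omega p u ('i%C *: u))).

(* U is an open subset of E, q a covering of Y by U, and F a fibre norm on the
   tangent bundle of U which is invariant under the deck group, hence a norm on
   the tangent bundle of Y.  Piecewise C^1 paths of Y are the projections of
   those of U, with the same length; a piecewise C^1 path is the list of its
   C^1 pieces, each one parametrised by [0, 1]. *)
Section LengthDistance.
Variables (R : realType) (E : normedModType R) (Y : Type).
Variables (U : set E) (q : E -> Y) (F : E -> E -> R).

Definition C1_piece (c : R -> E) :=
  [/\ forall x : R, derivable c x 1, continuous (derive1 c)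
    & forall x : R, 0 <= x <= 1 -> U (c x)].

Fixpoint path_from_to (cs : seq (R -> E)) (x y : E) : Prop :=
  if cs is c :: cs' then
    [/\ C1_piece c, c 0 = x & path_from_to cs' (c 1) y]
  else U x /\ x = y.

Definition piece_length (c : R -> E) : R :=
  (\int[lebesgue_measure]_(x in `[0%R, 1%R]) F (c x) (derive1 c x))%R.

Definition length_dist (y y' : Y) : R :=
  inf [set l | exists x x' cs,
    [/\ path_from_to cs x x', q x = y, q x' = y'
      & l = \sum_(c <- cs) piece_length c]].

End LengthDistance.

(* Real coordinates ((Re w, Im w), (Re z, Im z)) on C2. *)
Definition R4 (R : realType) : normedModType R :=
  ((R^o * R^o) * (R^o * R^o))%type.

Definition cpoint (R : realType) (x : R4 R) : C2 R :=
  (x.1.1 +i* x.1.2, x.2.1 +i* x.2.2).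

Definition dist_t (R : realType) (S : Type) (q : C2 R -> S) (mu M : R)
    (Theta : C2 R -> {linear C2 R -> R[i]^o}) (t : R) : S -> S -> R :=
  length_dist (@cpoint R @^-1` @Xcov R) (q \o @cpoint R)
    (fun x v : R4 R => riem_norm (Omega mu M Theta t) (cpoint x) (cpoint v)).

Definition green_block (R : realType) (S : Type) (q : C2 R -> S) (k : nat)
    (s0 rad : R) : set S :=
  q @` [set p | [/\ s0 <= s_of p <= k%:R * s0, 0 <= theta_of p <= 2 * pi
                  & cabs p.2 <= rad]].

Definition green_length (R : realType) (k : nat) : R := ln k%:R / 2.

(* A point of R / l Z is a coset. *)
Definition green_proj (R : realType) (k : nat) (rho : R) : set R :=
  [set rho + m%:~R * green_length R k | m in [set: int]].

Definition green_circle (R : realType) (k : nat) : set (set R) :=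
  range (@green_proj R k).

Definition green_dist (R : realType) (k : nat) (mu : R)
  : set R -> set R -> R :=
  length_dist [set: R^o] (@green_proj R k : R^o -> set R)
    (fun (_ v : R^o) => Num.sqrt (2 * (2 - mu) * v ^+ 2)).

Definition hausdorff_dist (R : realType) (Z : metricType R) (A B : set Z)
  : \bar R :=
  ereal_inf [set e%:E | e in [set e : R | [/\ 0 < e,
    forall a, A a -> exists2 b, B b & mdist a b < e
  & forall b, B b -> exists2 a, A a & mdist a b < e]]].

Definition GH_dist (R : realType) (T T' : Type) (A : set T) (dA : T -> T -> R)
    (B : set T') (dB : T' -> T' -> R) : \bar R :=
  ereal_inf [set e | exists (Z : metricType R) (i : T -> Z) (j : T' -> Z),
    [/\ forall x y, A x -> A y -> mdist (i x) (i y) = dA x y,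
        forall x y, B x -> B y -> mdist (j x) (j y) = dB x y
      & e = hausdorff_dist (i @` A) (j @` B)]].

(* Main.v *)
(* Write s = - Re w.  The deck group multiplies s by powers of k, so log s / 2
   descends to a map onto the Green circle.  The metric of Omega_t dominates
   A(t) / 2 (dlog s)^2, whence a lower bound of d_t by the distance of the Green
   circle, up to the factor sqrt (A(t) / (2 - mu)), which tends to 1.

   Conversely, on a compact part of the universal cover the z-direction has
   length O(e^(-t/2)), and the theta-circle at height s has length O(1 / s).
   The latter does not go to 0 with t, but a point of the block may be replaced
   by its images under the powers of G, along which s grows like k^n.  So two
   points of the block are joined by a path whose length exceeds the one of a
   shortest arc in the Green circle by O(k^(-n)) + C_n e^(-t/2): choose n, then
   t.

   That d_t is a pseudometric needs the invariance of Omega_t under the deck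
   group, since a path has to be translated in order to be concatenated with
   another one. *)
From HB Require Import structures.
Require Import Defs.
From mathcomp Require Import all_boot all_order all_algebra.
From mathcomp Require Import all_classical all_reals all_analysis.
From mathcomp Require Import complex.
From mathcomp Require Import ring lra zify.
Set Implicit Arguments.
Unset Strict Implicit.
Unset Printing Implicit Defensive.
Import Order.TTheory GRing.Theory Num.Theory numFieldNormedType.Exports.
Local Open Scope classical_set_scope.
Local Open Scope ring_scope.

(** * Length distances *)

(** The paths behind [dist_t] may start and end at any lifts of the two points. So the lower bound
    has to minimise over all shifts of [log s / 2] by periods, and the upper bound has to realise
    the minimising shift. For two points of one block this shift is -1, 0 or 1 periods. The iterates
    of [G] in use therefore have exponents between [N] and [N.+2], and the images of the block stay
    in one compact box that depends on [N] only. A single bound of the coefficient of [Theta] on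
    that box makes the errors uniform over all pairs of points.

    The exponent [mu] is the one for which [s ^ mu |Theta|^2] is invariant: [G] multiplies [s] by
    [k] and [Theta] by [lam], and [k ^ mu * |lam| ^ 2 = 1]. The constant [2 (2 - mu)] of the circle
    comes from [d log s = 2 d rho].

    The comparison of the two spaces is a gluing along an almost isometry. Its triangle inequality
    needs a contraction factor at most 1, whereas [A(t)] tends to [2 - mu] from above or from below
    according to [M]; hence the minimum in the choice of that factor. *)

Lemma is_derive_comp_curve (R : realType) (E : normedModType R) (c : R -> E)
    (f : R -> R) (x a : R) (v : E) :
  is_derive (f x) (1 : R) c v -> is_derive x (1 : R) f a ->
  is_derive x (1 : R) (fun x => c (f x)) (a *: v).
Proof.
move=> dc df.
have /derivable1_diffP Dc : derivable c (f x) 1 by exact: ex_derive.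
have /derivable1_diffP Df : derivable f x 1 by exact: ex_derive.
have Dcf : differentiable (c \o f) x by exact: differentiable_comp.
apply: DeriveDef; first exact/derivable1_diffP.
rewrite -[LHS]/('D_1 (c \o f) x) deriveE// diff_comp//=.
have -> : 'd f x (1 : R) = a *: (1 : R) by rewrite -deriveE// derive_val
  scaler1.
by rewrite linearZ -deriveE// derive_val.
Qed.

Lemma is_derive_onem (R : realType) (x : R) :
  is_derive x (1 : R) (fun x : R => 1 - x) (- 1).
Proof. by rewrite -[X in is_derive _ _ _ X]add0r; apply: is_deriveB. Qed.

Section LengthDistTheory.
Variables (R : realType) (E : normedModType R) (Y : Type).
Variables (U : set E) (q : E -> Y) (F : E -> E -> R).
Hypothesis F_ge0 : forall x v, 0 <= F x v.
Hypothesis F_cont : forall c, C1_piece U c ->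
  {within `[0%R, 1%R], continuous (fun x : R => F (c x) (derive1 c x))}.

Local Notation dist := (length_dist U q F).
Local Notation path_length cs := (\sum_(c <- cs) piece_length F c).

Lemma path_endpoints cs x y : path_from_to U cs x y -> U x /\ U y.
Proof.
elim: cs x => [x [Ux <-]//|c cs IH x] /= [[_ _ Uc] <- /IH[_ Uy]].
by split=> //; apply: Uc; rewrite lexx ler01.
Qed.

Lemma path_cat cs cs' x y z : path_from_to U cs x y ->
  path_from_to U cs' y z -> path_from_to U (cs ++ cs') x z.
Proof.
elim: cs x => [x [_ <-]//|c cs IH x] /= [C1c cx pcs] pcs'.
by split=> //; exact: IH.
Qed.

Lemma is_derive_rev (c : R -> E) (x : R) : derivable c (1 - x) (1 : R) ->
  is_derive x (1 : R) (fun x : R => c (1 - x)) (- derive1 c (1 - x)).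
Proof.
move=> dc; rewrite -scaleN1r;
  apply: (is_derive_comp_curve (f := fun x => 1 - x)).
- by rewrite derive1E; exact/derivableP.
- exact: is_derive_onem.
Qed.

Lemma derive1_rev (c : R -> E) : (forall x : R, derivable c x (1 : R)) ->
  derive1 (fun x : R => c (1 - x)) = fun x => - derive1 c (1 - x).
Proof.
move=> dc; apply/funext => x; rewrite derive1E.
by have := is_derive_rev (dc (1 - x)) => /@derive_val ->.
Qed.

Lemma C1_piece_rev c : C1_piece U c -> C1_piece U (fun x : R => c (1 - x)).
Proof.
move=> [dc cc Uc]; split.
- by move=> x; have := is_derive_rev (dc (1 - x)) => /@ex_derive.
- rewrite derive1_rev// => x; apply: (@cvgN R).
  apply: continuous_comp; last exact: cc.
  by apply: (@cvgB R); [exact: cvg_cst|exact: cvg_id].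
- by move=> x x01; apply: Uc; lra.
Qed.

Hypothesis F_opp : forall x v, F x (- v) = F x v.

(** The substitution [x -> 1 - x] only changes the sign of the velocity, which [F_opp] absorbs;
    [F_cont] provides the continuous integrand that the substitution asks for. *)
Lemma piece_length_rev c : C1_piece U c ->
  piece_length F (fun x : R => c (1 - x)) = piece_length F c.
Proof.
move=> C1c; have [dc _ _] := C1c; rewrite /piece_length derive1_rev//.
rewrite [RHS]Rintegration_by_substitution_onem ?lexx ?ler01//; last first.
  exact: F_cont.
by rewrite /unstable.onem subrr; apply: eq_Rintegral => x _; rewrite F_opp.
Qed.

Lemma path_rev cs x y : path_from_to U cs x y ->
  exists2 cs', path_from_to U cs' y x & path_length cs' = path_length cs.
Proof.
elim: cs x => [x [Ux <-]|c cs IH x] /=; first by exists [::].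
move=> [C1c cx pcs]; have [cs' pcs' lcs'] := IH _ pcs.
exists (cs' ++ [:: fun x => c (1 - x)]).
  apply: path_cat pcs' _; split => /=; first exact: C1_piece_rev.
  - by rewrite subr0.
  - rewrite subrr cx; split=> //; rewrite -cx.
    by have [_ _] := C1c; apply; rewrite lexx ler01.
by rewrite big_cat/= big_seq1 big_cons lcs' piece_length_rev// addrC.
Qed.

Lemma piece_length_ge0 c : 0 <= piece_length F c.
Proof. by apply: Rintegral_ge0 => x _. Qed.

Lemma path_length_ge0 cs : 0 <= path_length cs.
Proof. by apply: sumr_ge0 => c _; exact: piece_length_ge0. Qed.

Lemma length_dist_ge0 y y' : 0 <= dist y y'.
Proof.
rewrite /length_dist; set L := [set _ | _].
(* Points that no path joins get the infimum of the empty set, which is 0 by convention. *)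
have [->|/set0P L0] := eqVneq L set0; first by rewrite inf0.
by apply: lb_le_inf => // _ [x [x' [cs [_ _ _ ->]]]]; exact: path_length_ge0.
Qed.

Lemma length_dist_le cs x x' : path_from_to U cs x x' ->
  dist (q x) (q x') <= path_length cs.
Proof.
move=> pcs; apply: ge_inf; last by exists x, x', cs.
by exists 0 => _ [? [? [? [_ _ _ ->]]]]; exact: path_length_ge0.
Qed.

(** The path [cs] keeps the set of lengths nonempty: otherwise its infimum would be the default
    value 0, whatever [l] is. *)
Lemma length_dist_ge cs x x' l : path_from_to U cs x x' ->
  (forall cs' z z', path_from_to U cs' z z' -> q z = q x -> q z' = q x' ->
     l <= path_length cs') ->
  l <= dist (q x) (q x').
Proof.
move=> pcs Hl; apply: lb_le_inf; first by exists (path_length cs), x, x', cs.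
by move=> _ [z [z' [cs' [pcs' qz qz' ->]]]]; exact: Hl pcs' qz qz'.
Qed.

Lemma length_dist_adherent cs x x' e : path_from_to U cs x x' -> 0 < e ->
  exists z z' cs', [/\ path_from_to U cs' z z', q z = q x, q z' = q x'
    & path_length cs' < dist (q x) (q x') + e].
Proof.
move=> pcs e0.
set L := [set l | exists z z' cs', [/\ path_from_to U cs' z z', q z = q x,
  q z' = q x' & l = path_length cs']].
have hL : has_inf L.
  split; first by exists (path_length cs), x, x', cs.
  by exists 0 => _ [? [? [? [_ _ _ ->]]]]; exact: path_length_ge0.
have [_ [z [z' [cs' [? ? ? ->]]]] ?] := inf_adherent e0 hL.
by exists z, z', cs'.
Qed.

Lemma length_dist_xx x : U x -> dist (q x) (q x) = 0.
Proof.
move=> Ux; apply/eqP; rewrite eq_le length_dist_ge0 andbT.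
by have := @length_dist_le [::] x x (conj Ux erefl); rewrite big_nil.
Qed.

Hypothesis U_path : forall x y, U x -> U y -> exists cs, path_from_to U cs x y.

Lemma length_dist_sym x x' : U x -> U x' ->
  dist (q x) (q x') = dist (q x') (q x).
Proof.
suff le_dist y y' : U y -> U y' -> dist (q y) (q y') <= dist (q y') (q y).
  by move=> Ux Ux'; apply/eqP; rewrite eq_le !le_dist.
move=> Uy Uy'; have [cs pcs] := U_path Uy' Uy.
apply: length_dist_ge (pcs) _ => cs' z z' pcs' qz qz'.
have [cs'' pcs'' <-] := path_rev pcs'.
by rewrite -qz -qz'; exact: length_dist_le.
Qed.

Hypothesis q_lift : forall x x', U x -> U x' -> q x = q x' ->
  exists g : E -> E, [/\ g x = x', forall y, U y -> U (g y) /\ q (g y) = q y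
    & forall c, C1_piece U c -> C1_piece U (g \o c) /\
      forall t, 0 <= t <= 1 ->
        F (g (c t)) (derive1 (g \o c) t) = F (c t) (derive1 c t)].

(** [q_lift] compares norms only at times in [[0, 1]], because a piece is required to stay in [U]
    only there. This is enough for lengths to agree piece by piece. *)
Lemma path_translate x x' cs y : path_from_to U cs x y -> U x' ->
  q x = q x' -> exists cs' y', [/\ path_from_to U cs' x' y', q y' = q y
    & path_length cs' = path_length cs].
Proof.
move=> pcs Ux' qxx'; have [Ux Uy] := path_endpoints pcs.
have [g [<- gU gF]] := q_lift Ux Ux' qxx'.
exists (map (comp g) cs), (g y); split; last 1 first.
- rewrite big_map; elim: cs x pcs {Ux qxx'} => [|c cs IH] x /=.
    by move=> _; rewrite [LHS]big_nil [RHS]big_nil.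
  move=> [C1c _ /IH pcs]; rewrite [LHS]big_cons. rewrite [RHS]big_cons.
  refine (f_equal2 +%R _ pcs).
  by apply: eq_Rintegral => t; rewrite inE/= in_itv/= => t01;
    exact: (gF _ C1c).2.
- elim: cs x pcs {Ux qxx' Ux'} => [|c cs IH] x /=.
    by move=> [Ux <-]; split=> //; exact: (gU _ Ux).1.
  by move=> [C1c <- /IH pcs]; split => //; exact: (gF _ C1c).1.
- by rewrite (gU _ Uy).2.
Qed.

Lemma length_dist_triangle x y z : U x -> U y -> U z ->
  dist (q x) (q z) <= dist (q x) (q y) + dist (q y) (q z).
Proof.
move=> Ux Uy Uz; apply/ler_addgt0Pr => e e0.
have [cs0 pcs0] := U_path Ux Uy; have [cs1 pcs1] := U_path Uy Uz.
have e20 : 0 < e / 2 by rewrite divr_gt0.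
have [a [b [cs [pcs qa qb lcs]]]] := length_dist_adherent pcs0 e20.
have [c [d [cs' [pcs' qc qd lcs']]]] := length_dist_adherent pcs1 e20.
have [_ Ub] := path_endpoints pcs.
have [cs2 [d2 [pcs2 qd2 lcs2]]] := path_translate pcs' Ub (etrans qc (esym qb)).
have := length_dist_le (path_cat pcs pcs2).
rewrite qa qd2 qd big_cat/= lcs2 => /le_trans; apply.
by rewrite [e]splitr addrACA; apply: lerD; exact: ltW.
Qed.

Lemma piece_length_le c K : C1_piece U c ->
  (forall t, 0 <= t <= 1 -> F (c t) (derive1 c t) <= K) ->
  piece_length F c <= K.
Proof.
move=> C1c FK.
have -> : K = \int[@lebesgue_measure R]_(_ in `[0%R, 1%R]) K.
  rewrite Rintegral_cst; last exact: measurable_itv.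
  have mu01 : @lebesgue_measure R `[0%R, 1%R]%classic = 1%E.
    apply: etrans (lebesgue_measure_itv _) _.
    by rewrite lte_fin ltr01 sube0.
  by rewrite [X in fine X](_ : _ = 1%E) ?mulr1//.
apply: le_Rintegral => //.
- by apply: continuous_compact_integrable;
  [exact: segment_compact|exact: F_cont].
- apply: continuous_compact_integrable; first exact: segment_compact.
  by apply: continuous_subspaceT => x; exact: cvg_cst.
Qed.

Lemma length_dist_segment c K : C1_piece U c ->
  (forall t, 0 <= t <= 1 -> F (c t) (derive1 c t) <= K) ->
  dist (q (c 0)) (q (c 1)) <= K.
Proof.
move=> C1c FK; apply: le_trans (piece_length_le C1c FK).
have : path_from_to U [:: c] (c 0) (c 1).
  by split => //; split=> //; have [_ _] := C1c; apply; rewrite lexx ler01.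
by move=> /length_dist_le; rewrite big_seq1.
Qed.

(** * Lower bound of lengths by a calibrating function *)

Section LowerBound.
Variables (L : E -> R) (dL : E -> E -> R).
Hypothesis L_deriv : forall c, C1_piece U c ->
  {within `[0%R, 1%R], continuous (fun t : R => dL (c t) (derive1 c t))} /\
  forall t : R, 0 <= t <= 1 ->
    is_derive t (1 : R) (L \o c) (dL (c t) (derive1 c t)).
Hypothesis dL_le : forall x v, U x -> `|dL x v| <= F x v.

(** By the fundamental theorem of calculus the variation of [L] along the piece is the integral of
    [dL], which [F] dominates pointwise. Both the lower bound of [d_t] and that of the Green
    distance are instances. *)
Lemma piece_length_ge c : C1_piece U c ->
  `|L (c 1) - L (c 0)| <= piece_length F c.
Proof.
move=> C1c; have [cdL DL] := L_deriv C1c; have [_ _ Uc] := C1c.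
have idL : (@lebesgue_measure R).-integrable `[0%R, 1%R]
    (EFin \o (fun t : R => dL (c t) (derive1 c t))).
  by apply: continuous_compact_integrable; first exact: segment_compact.
have -> : L (c 1) - L (c 0) =
    \int[@lebesgue_measure R]_(t in `[0%R, 1%R]) dL (c t) (derive1 c t).
  rewrite /Rintegral (@continuous_FTC2 _ _ (L \o c))//.
  - split.
    + move=> t; rewrite in_itv/= => /andP[t0 t1].
      by apply: (@ex_derive _ _ _ _ _ _ _ (DL t _)); rewrite !ltW.
    + apply: cvg_at_right_filter; apply: differentiable_continuous.
      by apply/derivable1_diffP; apply: (@ex_derive _ _ _ _ _ _ _ (DL 0 _));
        rewrite lexx ler01.
    + apply: cvg_at_left_filter; apply: differentiable_continuous.
      by apply/derivable1_diffP; apply: (@ex_derive _ _ _ _ _ _ _ (DL 1 _));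
        rewrite lexx ler01.
  - move=> t; rewrite in_itv/= => /andP[t0 t1]; rewrite derive1E.
    by apply: (@derive_val _ _ _ _ _ _ _ (DL t _)); rewrite !ltW.
apply: le_trans (le_normr_Rintegral _ idL) _ => //.
apply: le_Rintegral => //.
- by rewrite (_ : EFin \o _ = abse \o (EFin \o (fun t : R =>
  dL (c t) (derive1 c t))))//; exact: integrable_abse.
- by apply: continuous_compact_integrable;
  [exact: segment_compact|exact: F_cont].
- by move=> t /=; rewrite in_itv/= => t01; apply: dL_le; exact: Uc.
Qed.

Lemma path_length_ge cs x y : path_from_to U cs x y ->
  `|L y - L x| <= path_length cs.
Proof.
elim: cs x => [x [_ ->]|c cs IH x] /=; first by rewrite subrr normr0 big_nil.
move=> [C1c <- /IH pcs]; rewrite big_cons.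
rewrite (_ : L y - _ = (L (c 1) - L (c 0)) + (L y - L (c 1))); last by ring.
by apply: le_trans (ler_normD _ _) _; apply: lerD => //; exact: piece_length_ge.
Qed.

End LowerBound.

End LengthDistTheory.

(** * Gromov-Hausdorff distance *)

Section PseudoMetricQuotient.
Variables (R : realType) (P : Type) (d : P -> P -> R).
Hypotheses (d_xx : forall x, d x x = 0) (d_sym : forall x y, d x y = d y x)
  (d_triangle : forall x y z, d x z <= d x y + d y z).

(* A point of the quotient is represented by its distance function. *)
Definition metric_quotient := {f : P -> R | `[< range d f >]}.

Definition mq_proj (x : P) : metric_quotient :=
  exist _ (d x) (introT (asboolP _) (imageT d x)).

Definition mq_repr (f : metric_quotient) : P :=
  projT1 (cid2 (elimT (asboolP _) (proj2_sig f))).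

Lemma mq_reprK f : d (mq_repr f) = proj1_sig f.
Proof. by rewrite /mq_repr; case: cid2. Qed.

Definition mq_dist (f g : metric_quotient) : R := d (mq_repr f) (mq_repr g).

Lemma mq_distE x y : mq_dist (mq_proj x) (mq_proj y) = d x y.
Proof. by rewrite /mq_dist mq_reprK/= d_sym mq_reprK/= d_sym. Qed.

Let mq_dist_xx f : mq_dist f f = 0. Proof. exact: d_xx. Qed.

Let mq_dist_sym f g : mq_dist f g = mq_dist g f. Proof. exact: d_sym. Qed.

Let mq_dist_triangle g f h : mq_dist f h <= mq_dist f g + mq_dist g h.
Proof. exact: d_triangle. Qed.

Let mq_dist_eq0 f g : mq_dist f g = 0 -> f = g.
Proof.
move=> fg0; apply: eq_sig_hprop => [? ? ?|]; first exact: bool_irrelevance.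
rewrite -!mq_reprK; apply/funext => z; apply/eqP; rewrite eq_le.
have := d_triangle (mq_repr f) (mq_repr g) z.
have := d_triangle (mq_repr g) (mq_repr f) z.
by rewrite (d_sym (mq_repr g) (mq_repr f)) -/(mq_dist f g) fg0 !add0r => -> ->.
Qed.

HB.instance Definition _ := gen_eqMixin metric_quotient.
HB.instance Definition _ := gen_choiceMixin metric_quotient.
HB.instance Definition _ := isMetric.Build R metric_quotient
  mq_dist_xx mq_dist_eq0 mq_dist_sym mq_dist_triangle.

(** [GH_dist] ranges over genuine metric spaces but asks its maps only to preserve distances, so
    points at distance 0 may be merged. *)
Lemma pseudometric_quotient : exists (Z : metricType R) (p : P -> Z),
  forall x y, mdist (p x) (p y) = d x y.
Proof. by exists metric_quotient, mq_proj => x y; exact: mq_distE. Qed.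

End PseudoMetricQuotient.

Section GromovHausdorff.
Variables (R : realType) (T T' : Type) (A : set T) (dA : T -> T -> R).
Variables (B : set T') (dB : T' -> T' -> R).

Definition pseudometric_on (X : Type) (D : set X) (d : X -> X -> R) :=
  [/\ forall x, D x -> d x x = 0, forall x y, D x -> D y -> d x y = d y x
    & forall x y z, D x -> D y -> D z -> d x z <= d x y + d y z].

Lemma GH_dist_ge0 : (0 <= GH_dist A dA B dB)%E.
Proof.
apply: le_ereal_inf_tmp => _ [Z [i [j [_ _ ->]]]].
by apply: le_ereal_inf_tmp => _ [e [e0 _ _] <-]; rewrite lee_fin ltW.
Qed.

(* The almost isometry [pi] glues [A] and [B]: [x] in [A] and [y] in [B] are
   put at distance [c * dB (pi x) y + e]. *)
Lemma GH_dist_le (pi : T -> T') (c e : R) :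
  A !=set0 -> pseudometric_on A dA -> pseudometric_on B dB ->
  (forall x, A x -> B (pi x)) ->
  (forall y, B y -> exists2 x, A x & pi x = y) ->
  0 < e -> 0 <= c <= 1 ->
  (forall x x', A x -> A x' ->
     c * dB (pi x) (pi x') <= dA x x' <= c * dB (pi x) (pi x') + 2 * e) ->
  (forall y y', B y -> B y' -> 0 <= dB y y' <= c * dB y y' + 2 * e) ->
  (GH_dist A dA B dB <= (2 * e)%:E)%E.
Proof.
move=> [x0 Ax0] [Axx Asym Atri] [Bxx Bsym Btri] piB Bpi e0 /andP[c0 c1] dAB dBc.
pose P := ({x | A x} + {y | B y})%type.
pose d (u v : P) : R := match u, v with
  | inl x, inl x' => dA (sval x) (sval x')
  | inl x, inr y => c * dB (pi (sval x)) (sval y) + e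
  | inr y, inl x => c * dB (pi (sval x)) (sval y) + e
  | inr y, inr y' => dB (sval y) (sval y')
  end.
have d_xx u : d u u = 0 by case: u => [[x Ax]|[y By]] /=;
  [exact: Axx|exact: Bxx].
have d_sym u v : d u v = d v u.
  by case: u v => [[x Ax]|[y By]] [[x' Ax']|[y' By']] //=;
    [exact: Asym|exact: Bsym].
have cB x y z : B x -> B y -> B z -> c * dB x z <= c * dB x y + c * dB y z.
  by move=> Bx By Bz; rewrite -mulrDr ler_wpM2l//; exact: Btri.
have cB1 x y : B x -> B y -> c * dB x y <= dB x y.
  by move=> Bx By; rewrite ler_piMl//; have /andP[] := dBc _ _ Bx By.
(* A detour inside [A] is paid by the lower bound [c * dB <= dA], a detour inside [B] by [c <= 1].
   Crossing to the other side and back costs [2 * e], which is the slack in the upper bounds of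
   [dAB] and [dBc]. *)
have d_tri u v w : d u w <= d u v + d v w.
  case: u v w => [[x Ax]|[y By]] [[x' Ax']|[y' By']] [[x'' Ax'']|[y'' By'']] /=.
  - exact: Atri.
  - have /andP[h _] := dAB _ _ Ax Ax'; rewrite addrA lerD2r.
    by apply: le_trans (cB _ (pi x') _ _ _ _) _; rewrite ?lerD2r//; exact: piB.
  - have /andP[_ h] := dAB _ _ Ax Ax''; apply: le_trans h _.
    have := cB _ _ _ (piB _ Ax) By' (piB _ Ax'').
    by rewrite (Bsym y' (pi x''))//; [lra|exact: piB].
  - have := cB _ _ _ (piB _ Ax) By' By''; have := cB1 _ _ By' By''; lra.
  - have /andP[h _] := dAB _ _ Ax' Ax''.
    have := cB _ _ _ (piB _ Ax'') (piB _ Ax') By.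
    by rewrite (Bsym (pi x'') (pi x')); [lra|exact: piB..].
  - have /andP[_ h] := dBc _ _ By By''; apply: le_trans h _.
    have := cB _ _ _ By (piB _ Ax') By''.
    by rewrite (Bsym y (pi x'))//; [lra|exact: piB].
  - have := cB _ _ _ (piB _ Ax'') By' By; have := cB1 _ _ By' By.
    by rewrite (Bsym y' y)//; lra.
  - exact: Btri.
have [Z [p pE]] := pseudometric_quotient d_xx d_sym d_tri.
(* [GH_dist] uses total maps but constrains them on [A] and [B] only; elsewhere the value is the
   arbitrary point [x0]. *)
pose i x := if pselect (A x) is left Ax then p (inl (exist _ x Ax))
  else p (inl (exist _ x0 Ax0)).
pose j y := if pselect (B y) is left By then p (inr (exist _ y By))
  else p (inl (exist _ x0 Ax0)).
have iE x (Ax : A x) : i x = p (inl (exist _ x Ax)).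
  by rewrite /i; case: pselect => // Ax'; rewrite (Prop_irrelevance Ax' Ax).
have jE y (By : B y) : j y = p (inr (exist _ y By)).
  by rewrite /j; case: pselect => // By'; rewrite (Prop_irrelevance By' By).
(* The distance is exactly [e]; the strict inequality in [hausdorff_dist] makes [2 * e] an
   admissible radius. *)
have ij x (Ax : A x) : mdist (i x) (j (pi x)) < 2 * e.
  rewrite (iE _ Ax) (jE _ (piB _ Ax)) pE/= Bxx ?mulr0 ?add0r; [lra|exact: piB].
apply: (@le_trans _ _ (hausdorff_dist (i @` A) (j @` B))).
  apply: ereal_inf_lbound; exists Z, i, j; split=> //.
  - by move=> x y Ax Ay; rewrite (iE _ Ax) (iE _ Ay) pE.
  - by move=> x y Bx By; rewrite (jE _ Bx) (jE _ By) pE.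
apply: ereal_inf_lbound; exists (2 * e) => //; split; first lra.
- move=> _ [x Ax <-]; exists (j (pi x)); last exact: ij.
  by exists (pi x) => //; exact: piB.
- move=> _ [y By <-]; have [x Ax <-] := Bpi _ By.
  by exists (i x); [exists x|exact: ij].
Qed.

End GromovHausdorff.

Local Open Scope complex_scope.
Local Notation Re := (@complex.Re _).
Local Notation Im := (@complex.Im _).

(** * Limits in C and in R^4 *)

Section ComplexTopology.
Variable R : realType.
Local Notation C := R[i].
Implicit Types z w : C.

Lemma normr_cabs z : `|z| = (cabs z)%:C.
Proof. by case: z. Qed.

Lemma cabs_ge0 z : 0 <= cabs z.
Proof. by rewrite -ler0c -normr_cabs. Qed.

Lemma cabs_gt0 z : z != 0 -> 0 < cabs z.
Proof. by move=> z0; rewrite -ltcR -normr_cabs normr_gt0. Qed.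

Lemma cabsE z : cabs z = Num.sqrt (Re z ^+ 2 + Im z ^+ 2).
Proof. by case: z. Qed.

Lemma cabs_sqr z : cabs z ^+ 2 = Re z ^+ 2 + Im z ^+ 2.
Proof. by rewrite cabsE sqr_sqrtr// addr_ge0// sqr_ge0. Qed.

Lemma cabsM z w : cabs (z * w) = cabs z * cabs w.
Proof. exact: Normc.normcM. Qed.

Lemma cabsD z w : cabs (z + w) <= cabs z + cabs w.
Proof. exact: le_normcD. Qed.

Lemma normr_Re_le z : `|Re z| <= cabs z.
Proof.
rewrite -ler_sqr ?nnegrE ?normr_ge0 ?cabs_ge0// cabs_sqr real_normK ?num_real//.
by rewrite lerDl sqr_ge0.
Qed.

Lemma normr_Im_le z : `|Im z| <= cabs z.
Proof.
rewrite -ler_sqr ?nnegrE ?normr_ge0 ?cabs_ge0// cabs_sqr real_normK ?num_real//.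
by rewrite lerDr sqr_ge0.
Qed.

Lemma cabs_le z : cabs z <= `|Re z| + `|Im z|.
Proof.
rewrite -ler_sqr ?nnegrE ?addr_ge0 ?cabs_ge0 ?normr_ge0// cabs_sqr sqrrD.
rewrite !real_normK ?num_real//.
have : 0 <= `|Re z| * `|Im z| by rewrite mulr_ge0.
by rewrite -mulr_natr; lra.
Qed.

Lemma ReB z w : Re (z - w) = Re z - Re w. Proof. by case: z; case: w. Qed.
Lemma ImB z w : Im (z - w) = Im z - Im w. Proof. by case: z; case: w. Qed.

(* A record, to keep unification from unfolding limits in [C]. *)
Record ccvg {T : Type} (F : set_system T) (f : T -> C) z : Prop :=
  Ccvg { ccvg_limit : f @ F --> (z : C^o) }.

Definition cnbhs z : set_system C := nbhs (z : C^o).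

#[global] Instance cnbhs_filter z : ProperFilter (cnbhs z).
Proof. exact: (@nbhs_pfilter C^o). Qed.

Section Convergence.
Context {T : Type} {F : set_system T} {FF : Filter F}.

Lemma cvgCP (f : T -> C) z :
  ccvg F f z <-> Re \o f @ F --> (Re z : R^o) /\ Im \o f @ F --> (Im z : R^o).
Proof.
split=> [[/(@cvgrPdist_lt C C^o) fz]|[/(@cvgrPdist_lt R R^o) fx /(@cvgrPdist_lt
  R R^o) fy]].
  split; apply/(@cvgrPdist_lt R R^o) => e e0; have := fz e%:C;
    rewrite ltcR => /(_ e0);
    apply: filterS => t /=; rewrite normr_cabs ltcR; apply: le_lt_trans.
  - by rewrite -ReB; exact: normr_Re_le.
  - by rewrite -ImB; exact: normr_Im_le.
(* A positive radius in the numeric field [C] is a complex number with zero imaginary part, so only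
   its real part [e] matters. *)
split; apply/(@cvgrPdist_lt C C^o) => -[e e'];
  rewrite ltcE/= => /andP[/eqP-> e0].
have e20 : 0 < e / 2 by rewrite divr_gt0.
near=> t; rewrite normr_cabs ltcR; apply: le_lt_trans (cabs_le _) _.
rewrite ReB ImB [e]splitr; apply: ltrD; near: t; [exact: fx|exact: fy].
Unshelve. all: by end_near. Qed.

Lemma cvg_Complex (f g : T -> R) x y : f @ F --> (x : R^o) ->
  g @ F --> (y : R^o) ->
  ccvg F (fun t => f t +i* g t) (x +i* y).
Proof. by move=> fx gy; apply/cvgCP. Qed.

Lemma cvg_cabs (f : T -> C) z : ccvg F f z ->
  @cabs R \o f @ F --> (cabs z : R^o).
Proof.
move=> /cvgCP[fx fy].
have -> : @cabs R \o f = fun t =>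
  Num.sqrt ((Re \o f) t * (Re \o f) t + (Im \o f) t * (Im \o f) t).
  by apply/funext => t /=; rewrite cabsE !expr2.
rewrite cabsE !expr2; apply: (@continuous_cvg _ _ _ _ _ _ (@Num.sqrt R)).
  exact: sqrt_continuous.
exact: (cvgD (cvgM fx fx) (cvgM fy fy)).
Qed.

End Convergence.

Section ComplexLimits.
Context {T : Type} {F : set_system T} {FF : Filter F}.
Implicit Types f g : T -> C.

Lemma ccvg_cst z : ccvg F (fun=> z) z.
Proof. by split; exact: (@cvg_cst C^o z T F FF). Qed.

Lemma ccvgD f g z w : ccvg F f z -> ccvg F g w ->
  ccvg F (fun t => f t + g t) (z + w).
Proof. by move=> [fz] [gw]; split; refine (@cvgD C C^o T F FF f g z w fz gw).
Qed.

Lemma ccvgM f g z w : ccvg F f z -> ccvg F g w ->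
  ccvg F (fun t => f t * g t) (z * w).
Proof. by move=> [fz] [gw]; split; refine (@cvgM C T F FF f g z w fz gw). Qed.

Lemma ccvgV f z : z != 0 -> ccvg F f z -> ccvg F (fun t => (f t)^-1) z^-1.
Proof. by move=> z0 [fz]; split; refine (@cvgV C T F FF f z z0 fz). Qed.

Lemma ccvg_real (f : T -> R) x : f @ F --> (x : R^o) ->
  ccvg F (fun t => (f t)%:C) x%:C.
Proof.
by move=> fx; apply: cvg_Complex => //; exact: (@cvg_cst R^o 0 T F FF).
Qed.

Lemma ccvg_comp f (g : C -> C) z w : ccvg F f z -> ccvg (cnbhs z) g w ->
  ccvg F (fun t => g (f t)) w.
Proof. by move=> [fz] [gw]; split; exact: cvg_comp fz gw. Qed.

Lemma ccvg_near f g z : (\forall t \near F, f t = g t) -> ccvg F f z ->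
  ccvg F g z.
Proof. by move=> fg [fz]; split; apply: cvg_trans fz; exact: near_eq_cvg. Qed.

Lemma ccvg_squeeze f z (b : T -> R) :
  (\forall t \near F, cabs (f t - z) <= b t) -> b @ F --> (0 : R^o) ->
  ccvg F f z.
Proof.
move=> fb /(@cvgrPdist_lt R R^o) b0.
split; apply/(@cvgrPdist_lt C C^o) => -[e e'];
  rewrite ltcE/= => /andP[/eqP-> e0].
near=> t; rewrite distrC normr_cabs ltcR; apply: le_lt_trans (_ : b t < e).
  by near: t.
have : `|0 - b t| < e by near: t; exact: b0.
by rewrite sub0r normrN; apply: le_lt_trans; exact: ler_norm.
Unshelve. all: by end_near. Qed.

End ComplexLimits.

Lemma ccvg_id w : ccvg (cnbhs w) id w.
Proof. by split; exact: cvg_id. Qed.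

Definition ccont (h : C -> C) := forall w, ccvg (cnbhs w) h (h w).

Lemma cvg_prod (T : Type) (U V : topologicalType) (F : set_system T)
    {FF : Filter F} (f : T -> U) (g : T -> V) (a : U) (b : V) :
  f @ F --> a -> g @ F --> b -> (fun t => (f t, g t)) @ F --> (a, b).
Proof. exact: cvg_pair. Qed.

Definition rpoint (p : C2 R) : R4 R := ((Re p.1, Im p.1), (Re p.2, Im p.2)).

Lemma cpointK : cancel (@Defs.cpoint R) rpoint.
Proof. by case=> [[a b] [c d]]. Qed.

Lemma rpointK : cancel rpoint (@Defs.cpoint R).
Proof. by case=> [[a b] [c d]]. Qed.

Lemma cpoint_continuous : continuous (@Defs.cpoint R).
Proof.
move=> x; rewrite /Defs.cpoint; apply: cvg_prod; apply: ccvg_limit;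
  apply: cvg_Complex.
- apply: (@continuous_comp _ _ _ fst fst); [exact: cvg_fst|exact: cvg_fst].
- apply: (@continuous_comp _ _ _ fst snd); [exact: cvg_fst|exact: cvg_snd].
- apply: (@continuous_comp _ _ _ snd fst); [exact: cvg_snd|exact: cvg_fst].
- apply: (@continuous_comp _ _ _ snd snd); [exact: cvg_snd|exact: cvg_snd].
Qed.

(** The derivative along a real parameter is written as a limit because [C^o] is a normed space over
    [R[i]], not over the field [R] of the parameter. *)
Definition dcurve (w : R -> C) (t : R) (w' : C) :=
  ccvg 0^' (fun e : R => (e^-1)%:C * (w (e + t) - w t)) w'.

Lemma is_deriveP (K : numFieldType) (V W : normedModType K) (f : V ->
  W) a v df :
  is_derive a v f df <->
  (fun h : K => h^-1 *: (f (h *: v + a) - f a)) @ 0^' --> df.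
Proof.
split=> [[fd <-]|fdf]; first exact: fd.
by apply: DeriveDef; [apply: cvgP fdf|apply: cvg_lim fdf].
Qed.

(** The bridge between curves of [R4], in which paths are defined, and pairs of complex curves, on
    which deck transformations act by formulas. *)
Lemma is_derive_dcurve (c : R -> R4 R) (t : R) (v : R4 R) :
  is_derive t (1 : R) c v <->
  dcurve (fun t => (Defs.cpoint (c t)).1) t (Defs.cpoint v).1 /\
  dcurve (fun t => (Defs.cpoint (c t)).2) t (Defs.cpoint v).2.
Proof.
have ReM (a : R) z : Re (a%:C * z) = a * Re z by case: z => x y /=; ring.
have ImM (a : R) z : Im (a%:C * z) = a * Im z by case: z => x y /=; ring.
set q := fun e : R => e^-1 *: (c (e + t) - c t).
have qE : (fun e : R => e^-1 *: (c (e *: (1 : R) + t) - c t)) = q.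
  by apply/funext => e; rewrite /q [e *: _]mulr1.
split=> [/is_deriveP|[/cvgCP[xx xy] /cvgCP[zx zy]]].
  rewrite qE => qv; split; apply/cvgCP; split.
  - have : (fst \o fst) \o q @ 0^' --> v.1.1.
      apply: (@continuous_cvg _ _ _ _ _ _ (fst \o fst) _ _ qv).
      by apply: continuous_comp; exact: cvg_fst.
    by apply: cvg_trans; apply: near_eq_cvg; apply: nearW => e;
      rewrite /comp ReM ReB.
  - have : (snd \o fst) \o q @ 0^' --> v.1.2.
      apply: (@continuous_cvg _ _ _ _ _ _ (snd \o fst) _ _ qv).
      by apply: continuous_comp; [exact: cvg_fst|exact: cvg_snd].
    by apply: cvg_trans; apply: near_eq_cvg; apply: nearW => e;
      rewrite /comp ImM ImB.
  - have : (fst \o snd) \o q @ 0^' --> v.2.1.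
      apply: (@continuous_cvg _ _ _ _ _ _ (fst \o snd) _ _ qv).
      by apply: continuous_comp; [exact: cvg_snd|exact: cvg_fst].
    by apply: cvg_trans; apply: near_eq_cvg; apply: nearW => e;
      rewrite /comp ReM ReB.
  - have : (snd \o snd) \o q @ 0^' --> v.2.2.
      apply: (@continuous_cvg _ _ _ _ _ _ (snd \o snd) _ _ qv).
      by apply: continuous_comp; exact: cvg_snd.
    by apply: cvg_trans; apply: near_eq_cvg; apply: nearW => e;
      rewrite /comp ImM ImB.
apply/is_deriveP; rewrite qE.
have -> : q = fun e => (((q e).1.1, (q e).1.2), ((q e).2.1, (q e).2.2)).
  by apply/funext => e; case: (q e) => [[? ?] [? ?]].
have -> : v = ((v.1.1, v.1.2), (v.2.1,
  v.2.2)) by case: v {xx xy zx zy} => [[? ?] [? ?]].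
apply: cvg_prod; apply: cvg_prod.
- by apply: cvg_trans xx; apply: near_eq_cvg; apply: nearW => e;
  rewrite /comp ReM ReB.
- by apply: cvg_trans xy; apply: near_eq_cvg; apply: nearW => e;
  rewrite /comp ImM ImB.
- by apply: cvg_trans zx; apply: near_eq_cvg; apply: nearW => e;
  rewrite /comp ReM ReB.
- by apply: cvg_trans zy; apply: near_eq_cvg; apply: nearW => e;
  rewrite /comp ImM ImB.
Qed.

End ComplexTopology.

(** * Entire functions *)

Section Entire.
Variable R : realType.
Local Notation C := R[i].
Implicit Types (h g : C -> C) (z w : C).

(** Caratheodory's form of complex differentiability: sums, products and compositions are obtained
    by combining slopes, without dividing. *)
Definition complex_caratheodory h (dh : C -> C) := forall w,
  exists phi : C -> C,
  [/\ forall v, h v - h w = phi v * (v - w),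
      ccvg (cnbhs w) phi (phi w) & phi w = dh w].

(** Continuity of [dh] is included because the image of a C1 piece by a deck transformation has to
    be C1 again, and because [dh] enters the averaged metric. *)
Definition entire h (dh : C -> C) :=
  complex_caratheodory h dh /\ ccont dh.

Lemma ccvg_subr w : ccvg (cnbhs w) (fun v => v - w) (w - w).
Proof. by apply: ccvgD; [exact: ccvg_id|exact: ccvg_cst]. Qed.

Lemma entire_continuous h dh : entire h dh -> ccont h.
Proof.
move=> [hh _] w; have [phi [hE phic _]] := hh w.
have : ccvg (cnbhs w) (fun v => h w + phi v * (v - w)) (h w + phi w * (w - w)).
  apply: ccvgD; first exact: ccvg_cst.
  by apply: ccvgM => //; exact: ccvg_subr.
rewrite subrr mulr0 addr0; apply: ccvg_near.
by apply: nearW => v; rewrite -hE addrC subrK.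
Qed.

Lemma entire_cst z : entire (fun=> z) (fun=> 0).
Proof.
split=> [w|w]; last exact: ccvg_cst.
by exists (fun=> 0); split=> // [v|]; [rewrite mul0r subrr|exact: ccvg_cst].
Qed.

Lemma entire_id : entire id (fun=> 1).
Proof.
split=> [w|w]; last exact: ccvg_cst.
by exists (fun=> 1); split=> // [v|]; [rewrite mul1r|exact: ccvg_cst].
Qed.

Lemma entireD h dh g dg : entire h dh -> entire g dg ->
  entire (fun w => h w + g w) (fun w => dh w + dg w).
Proof.
move=> [hh dhc] [gg dgc]; split; last first.
  by move=> w; apply: ccvgD; [exact: dhc|exact: dgc].
move=> w; have [phi [hE phic phiw]] := hh w; have [psi [gE psic psiw]] := gg w.
exists (fun v => phi v + psi v); split.
- by move=> v; rewrite mulrDl -hE -gE; ring.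
- exact: ccvgD.
- by rewrite phiw psiw.
Qed.

Lemma entireM h dh g dg : entire h dh -> entire g dg ->
  entire (fun w => h w * g w) (fun w => dh w * g w + h w * dg w).
Proof.
move=> Eh Eg; have hc := entire_continuous Eh; have gc := entire_continuous Eg.
case: Eh Eg => [hh dhc] [gg dgc]; split; last first.
  move=> w; apply: ccvgD; apply: ccvgM.
  - exact: dhc.
  - exact: gc.
  - exact: hc.
  - exact: dgc.
move=> w; have [phi [hE phic phiw]] := hh w; have [psi [gE psic psiw]] := gg w.
exists (fun v => phi v * g w + h v * psi v); split.
- by move=> v; rewrite mulrDl mulrAC -hE -mulrA -gE; ring.
- apply: ccvgD; apply: ccvgM => //; exact: ccvg_cst.
- by rewrite phiw psiw.
Qed.

Lemma entire_comp h dh g dg : entire h dh -> entire g dg ->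
  entire (fun w => h (g w)) (fun w => dh (g w) * dg w).
Proof.
move=> Eh Eg; have gc := entire_continuous Eg.
case: Eh Eg => [hh dhc] [gg dgc]; split; last first.
  move=> w; apply: ccvgM; last exact: dgc.
  exact: ccvg_comp (gc w) (dhc _).
move=> w; have [phi [hE phic phiw]] := hh (g w).
have [psi [gE psic psiw]] := gg w.
exists (fun v => phi (g v) * psi v); split.
- by move=> v; rewrite hE gE mulrA.
- apply: ccvgM => //.
  exact: ccvg_comp (gc w) phic.
- by rewrite phiw psiw.
Qed.

Lemma cexpD z w : cexp (z + w) = cexp z * cexp w.
Proof.
case: z w => [x y] [x' y']; rewrite /cexp /= expRD cosD sinD.
by apply/eqP; rewrite eq_complex/=; apply/andP; split; apply/eqP; ring.
Qed.

Lemma cexp0 : cexp 0 = 1 :> C.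
Proof. by rewrite /cexp /= expR0 cos0 sin0 mulr1 mulr0. Qed.

Lemma cexp_continuous : ccont (@cexp R).
Proof.
move=> w; have [xw yw] := (cvgCP id w).1 (ccvg_id w).
have ex : (fun v => expR (Re v)) @ cnbhs w --> (expR (Re w) : R^o).
  apply: (@continuous_cvg _ _ _ _ _ _ (@expR R) _ _ xw); exact: continuous_expR.
apply: cvg_Complex; apply: (@cvgM R) => //.
- apply: (@continuous_cvg _ _ _ _ _ _ (@cos R) _ _ yw); exact: continuous_cos.
- apply: (@continuous_cvg _ _ _ _ _ _ (@sin R) _ _ yw); exact: continuous_sin.
Qed.

(** With [E], [K], [G] the slopes at 0 of [expR], [cos] and [sin], the real and imaginary parts of
    [cexp v - 1 - v] are [(E x - 1) x + expR x * K y * y] and [(expR x * G y - 1) y]. Both are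
    [o(|v|)], as [E] and [G] tend to 1 and [K] to 0. The functional equation [cexpD] then carries
    the slope to any other point. *)
Lemma cexp_caratheodory0 : exists phi : C -> C,
  [/\ forall v, cexp v - 1 = phi v * v, ccvg (cnbhs 0) phi (phi 0)
    & phi 0 = 1].
Proof.
have [E [EE Ec E0]] := (is_derive1_caratheodory (@expR R) 0 _).1
  (is_derive_expR 0).
have [K [KE Kc K0]] := (is_derive1_caratheodory (@cos R) 0 _).1 (is_derive_cos
  0).
have [G [GE Gc G0]] := (is_derive1_caratheodory (@sin R) 0 _).1 (is_derive_sin
  0).
rewrite expR0 in EE E0; rewrite cos0 in KE G0; rewrite sin0 in GE K0.
rewrite oppr0 in K0.
pose phi (v : C) := if v == 0 then 1 else (cexp v - 1) / v.
have phi0 : phi 0 = 1 by rewrite /phi eqxx.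
exists phi; rewrite phi0; split=> //.
  move=> v; rewrite /phi; have [->|v0] := eqVneq v 0.
    by rewrite cexp0 subrr mulr0.
  by rewrite divfK.
pose b (v : C) := `|E (Re v) - 1| + `|expR (Re v) * K (Im v)|
  + `|expR (Re v) * G (Im v) - 1|.
apply: (ccvg_squeeze (b := b)).
  apply: nearW => v; rewrite /phi; have [_|v0] := eqVneq v 0.
    by rewrite subrr /cabs Normc.normc0 !addr_ge0.
  rewrite -(ler_pM2r (cabs_gt0 v0)) -cabsM mulrBl divfK// mul1r.
  have xv := normr_Re_le v; have yv := normr_Im_le v.
  apply: le_trans (cabs_le _) _; rewrite !ReB !ImB /b /cexp.
  move: (Re v) (Im v) (cabs v) xv yv => x y c xv yv /=.
  have -> : expR x * cos y - 1 - x = (E x - 1) * x + (expR x * K y) * y.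
    have := EE x; have := KE y; rewrite !subr0 => Hc He.
    by rewrite mulrBl mul1r -He -mulrA -Hc; ring.
  have -> : expR x * sin y - 0 - y = (expR x * G y - 1) * y.
    by have := GE y; rewrite !subr0 => ->; ring.
  rewrite [leRHS]mulrDl; apply: lerD.
    rewrite [leRHS]mulrDl; apply: le_trans (ler_normD _ _) _.
    by apply: lerD; rewrite normrM ler_wpM2l.
  by rewrite normrM ler_wpM2l.
have /cvgCP[xw yw] := @ccvg_id R 0.
have Ex : (fun v => E (Re v)) @ cnbhs (0 : C) --> (1 : R^o).
  by rewrite -E0; apply: (@continuous_cvg _ _ _ _ _ _ E _ _ xw); exact: Ec.
have Kx : (fun v => K (Im v)) @ cnbhs (0 : C) --> (0 : R^o).
  by rewrite -[X in _ --> (X : R^o)]K0;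
    apply: (@continuous_cvg _ _ _ _ _ _ K _ _ yw); exact: Kc.
have Gx : (fun v => G (Im v)) @ cnbhs (0 : C) --> (1 : R^o).
  by rewrite -G0; apply: (@continuous_cvg _ _ _ _ _ _ G _ _ yw); exact: Gc.
have ex : (fun v => expR (Re v)) @ cnbhs (0 : C) --> (1 : R^o).
  by rewrite -expR0; apply: (@continuous_cvg _ _ _ _ _ _ (@expR R) _ _ xw);
    exact: continuous_expR.
have -> : 0 = `|1 - 1 : R| + `|(1 : R) * 0| + `|(1 : R) * 1 - 1| :> R.
  by rewrite mulr0 mulr1 subrr normr0 !addr0.
apply: (@cvgD R R^o); first apply: (@cvgD R R^o).
- by apply: (@cvg_norm R R^o); apply: (@cvgD R R^o); [exact: Ex|exact: cvg_cst].
- by apply: (@cvg_norm R R^o); exact: cvgM.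
- apply: (@cvg_norm R R^o); apply: (@cvgD R R^o); [exact: cvgM|exact: cvg_cst].
Qed.

Lemma entire_cexp : entire (@cexp R) (@cexp R).
Proof.
split; last exact: cexp_continuous.
move=> w; have [phi [phiE phic phi0]] := cexp_caratheodory0.
exists (fun v => cexp w * phi (v - w)); split.
- by move=> v; rewrite -mulrA -phiE mulrBr mulr1 -cexpD [w + _]addrC subrK.
- apply: ccvgM; first exact: ccvg_cst.
  by apply: ccvg_comp (ccvg_subr w) _; rewrite subrr; exact: phic.
- by rewrite subrr phi0 mulr1.
Qed.

Lemma entire_horner (p : {poly C}) g dg : entire g dg ->
  exists dh, entire (fun w => p.[g w]) dh.
Proof.
move=> Eg; elim/poly_ind: p => [|p c [dh Eh]].
  exists (fun=> 0).
  by under [fun w => _]eq_fun do rewrite horner0; exact: entire_cst.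
eexists; under [fun w => _]eq_fun do rewrite hornerMXaddC.
by apply: entireD; [apply: entireM; eassumption|exact: entire_cst].
Qed.

Lemma entire_affine (a b : C) : entire (fun w => a * w + b) (fun=> a).
Proof.
have := entireD (entireM (entire_cst a) entire_id) (entire_cst b).
by under [X in entire _ X -> _]eq_fun do rewrite mul0r mulr1 add0r addr0.
Qed.

Lemma entire_hfun (Q : {poly C}) : exists dh, entire (hfun Q) dh.
Proof.
have := entire_comp entire_cexp (entire_affine (-1) 0).
under [X in entire X _ -> _]eq_fun do rewrite addr0 mulN1r.
exact: entire_horner.
Qed.

Lemma dcurve_comp h dh (w : R -> C) (t : R) w' : entire h dh ->
  dcurve w t w' -> dcurve (h \o w) t (dh (w t) * w').
Proof.
move=> [hh _] ww'; have [phi [hE phic <-]] := hh (w t).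
rewrite /dcurve; under eq_fun do rewrite /= hE mulrCA.
apply: ccvgM => //.
(* Differentiability gives continuity: for [e != 0], [w (e + t)] is [w t] plus [e] times the
   difference quotient. *)
have w_cont : ccvg 0^' (fun e : R => w (e + t)) (w t).
  have -> : w t = 0%:C * w' + w t by rewrite mul0r add0r.
  apply: (@ccvg_near _ _ _ _ (fun e : R =>
    e%:C * ((e^-1)%:C * (w (e + t) - w t)) + w t)).
    near=> e.
    rewrite mulrA -rmorphM/= mulfV ?rmorph1 ?mul1r ?subrK//.
    by near: e; exact: nbhs_dnbhs_neq.
  apply: ccvgD; last exact: ccvg_cst.
  by apply: ccvgM => //; apply: ccvg_real; exact: cvg_within.
exact: ccvg_comp w_cont phic.
Unshelve. all: by end_near. Qed.

Lemma dcurveM a (w : R -> C) (t : R) w' :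
  dcurve w t w' -> dcurve (fun t => a * w t) t (a * w').
Proof.
move=> ww'; rewrite /dcurve; under eq_fun do rewrite -mulrBr mulrCA.
by apply: ccvgM => //; exact: ccvg_cst.
Qed.

Lemma dcurveD (w z : R -> C) (t : R) w' z' : dcurve w t w' -> dcurve z t z' ->
  dcurve (fun t => w t + z t) t (w' + z').
Proof.
move=> ww' zz'; rewrite /dcurve.
under eq_fun do rewrite opprD addrACA mulrDr.
exact: ccvgD.
Qed.

Lemma dcurve_cst z (t : R) : dcurve (fun=> z) t 0.
Proof. by rewrite /dcurve; under eq_fun do rewrite subrr mulr0;
  exact: ccvg_cst. Qed.

End Entire.

(** * The deck group *)

Section DeckGroup.
Variable R : realType.
Local Notation C := R[i].
Variables (k : nat) (mu : R).
Implicit Types (h dh : C -> C) (g : C2 R -> C2 R).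

(* The relation [deck_mu] makes [s ^ mu |dz|^2] invariant. *)
Record deck_form (a b : R) (l : C) h dh g : Prop := DeckForm {
  deck_a_gt0 : 0 < a;
  deck_a_pow : exists n : int, ln a = n%:~R * ln k%:R;
  deck_l_neq0 : l != 0;
  deck_mu : mu * ln a + 2 * ln (cabs l) = 0;
  deck_entire : entire h dh;
  deckE : forall p, g p = (a%:C * p.1 + 0 +i* b, l * p.2 + h p.1) }.

(** A normal form stable under composition and inverse. Everything used about the group is read off
    it: [s] is multiplied by an integral power of [k], the weights balance, and the shift is entire
    with a derivative carried as data. *)
Definition is_deck g := exists a b l h dh, deck_form a b l h dh g.

Lemma is_deck_id : is_deck id.
Proof.
exists 1, 0, 1, (fun=> 0), (fun=> 0); split=> //.
- by exists 0; rewrite ln1 mul0r.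
- by rewrite ln1 /cabs Normc.normc1 ln1 !mulr0 addr0.
- exact: entire_cst.
- by move=> [w z]; rewrite /= !mul1r !addr0.
Qed.

Lemma deck_form_comp a b l h dh g a' b' l' h' dh' g' :
  deck_form a b l h dh g -> deck_form a' b' l' h' dh' g' ->
  deck_form (a * a') (a * b' + b) (l * l')
    (fun w => l * h' w + h (a'%:C * w + 0 +i* b'))
    (fun w => l * dh' w + dh (a'%:C * w + 0 +i* b') * a'%:C) (g \o g').
Proof.
move=> [a0 [n na] l0 mual Eh gE] [a'0 [n' na'] l'0 mual' Eh' g'E]; split.
- exact: mulr_gt0.
- by exists (n + n'); rewrite lnM ?posrE// na na' intrD mulrDl.
- exact: mulf_neq0.
- by rewrite cabsM !lnM ?posrE ?cabs_gt0// -[RHS]addr0 -{1}mual -mual'; ring.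
- have := entireM (entire_cst l) Eh'.
  under [X in entire _ X -> _]eq_fun do rewrite mul0r add0r.
  move=> Elh; apply: entireD => //.
  by apply: entire_comp; [exact: Eh|exact: entire_affine].
- move=> p; rewrite /= g'E gE /=; congr pair.
    rewrite rmorphM/= mulrDr mulrA -addrA; congr (_ + _).
    by apply/eqP; rewrite eq_complex/=; apply/andP; split; apply/eqP; ring.
  by rewrite mulrDr mulrA addrA.
Qed.

Lemma is_deck_comp g g' : is_deck g -> is_deck g' -> is_deck (g \o g').
Proof.
move=> [a [b [l [h [dh gD]]]]] [a' [b' [l' [h' [dh' gD']]]]].
by do 5 eexists; exact: deck_form_comp gD gD'.
Qed.

Lemma is_deck_bij g : is_deck g -> exists2 g', cancel g g' & cancel g' g.
Proof.
move=> [a [b [l [h [dh [a0 _ l0 _ _ gE]]]]]].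
have aN0 : a%:C != 0 :> C by rewrite (inj_eq (@complexI R)) gt_eqF.
exists (fun p => ((a%:C)^-1 * (p.1 - 0 +i* b),
    l^-1 * (p.2 - h ((a%:C)^-1 * (p.1 - 0 +i* b))))) => -[w z]; rewrite gE /=.
- by rewrite addrK mulKf// addrK mulKf.
- by rewrite !mulVKf// !subrK.
Qed.

Lemma is_deck_inv g g' : is_deck g -> cancel g' g -> is_deck g'.
Proof.
move=> [a [b [l [h [dh [a0 [n na] l0 mual Eh gE]]]]]] g'K.
exists a^-1, (- (a^-1 * b)), l^-1.
exists (fun w => - l^-1 * h (a^-1%:C * w + 0 +i* (- (a^-1 * b)))).
eexists; split.
- by rewrite invr_gt0.
- by exists (- n); rewrite lnV ?posrE// na intrN mulNr.
- by rewrite invr_eq0.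
- have -> : cabs l^-1 = (cabs l)^-1 by exact: Normc.normcV.
  by rewrite !lnV ?posrE ?cabs_gt0// -[RHS]oppr0 -mual; ring.
- apply: entireM; first exact: entire_cst.
  by apply: entire_comp; [exact: Eh|exact: entire_affine].
- move=> p; have := g'K p; rewrite gE; case: p (g' p) => [w z] [w' z'] [<- <-].
  have aN0 : a%:C != 0 :> C by rewrite (inj_eq (@complexI R)) gt_eqF.
  have w'E : a^-1%:C * (a%:C * w' + 0 +i* b) + 0 +i* (- (a^-1 * b)) = w'.
    have -> : 0 +i* (- (a^-1 * b)) = - (a^-1%:C * (0 +i* b)).
      by apply/eqP; rewrite eq_complex/=; apply/andP; split; apply/eqP; ring.
    by rewrite mulrDr addrK mulrA -rmorphM/= mulVf ?gt_eqF// rmorph1 mul1r.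
  by rewrite /= w'E mulrDr mulrA mulVf// mul1r mulNr addrK.
Qed.

End DeckGroup.

Section DeckGroupForm.
Variable R : realType.
Local Notation C := R[i].
Variables (k r : nat) (lam : C) (Q : {poly C}).
Hypotheses (k_ge2 : (2 <= k)%N) (lam_neq0 : lam != 0).
Local Notation mu := (mu_of k lam).

Lemma lnk_gt0 : 0 < ln k%:R :> R.
Proof. by rewrite ln_gt0// ltr1n. Qed.

(** The weight relation is trivial for [deck_T] and [deck_phi], which have [a = 1] and [|l| = 1];
    for [deck_G] it is the definition of [mu]. *)
Lemma deck_group_form g : deck_group k r lam Q g -> is_deck k mu g.
Proof.
elim=> {g} [|g [->|->|[_ ->]]|g g' _ Dg _ Dg'|g g' _ Dg _].
- exact: is_deck_id.
- exists 1, (2 * pi), 1, (fun=> 0), (fun=> 0); split=> //.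
  + by exists 0; rewrite ln1 mul0r.
  + by rewrite ln1 /cabs Normc.normc1 ln1 !mulr0 addr0.
  + exact: entire_cst.
  + by move=> [w z]; rewrite /deck_T /= !mul1r !addr0.
- have [dh Eh] := entire_hfun Q.
  exists k%:R, 0, lam, (hfun Q), dh; split=> //.
  + by rewrite ltr0n (leq_trans _ k_ge2).
  + by exists 1; rewrite mul1r.
  + by rewrite /mu_of mulNr divfK ?gt_eqF ?lnk_gt0// addNr.
  + by move=> [w z]; rewrite /deck_G /= addr0 rmorph_nat.
- exists 1, (- (2 * pi / r%:R)), (deck_xi r Q), (fun=> 0), (fun=> 0).
  have xi1 : cabs (deck_xi r Q) = 1.
    by rewrite cabsE /deck_xi /cexp /= expR0 !mul1r cos2Dsin2 sqrtr1.
  split=> //.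
  + by exists 0; rewrite ln1 mul0r.
  + by apply/eqP => xi0; move: xi1;
    rewrite xi0 /cabs Normc.normc0 => /esym/eqP; rewrite oner_eq0.
  + by rewrite xi1 ln1 !mulr0 addr0.
  + exact: entire_cst.
  + move=> [w z]; rewrite /deck_phi /= mul1r addr0; congr pair; congr (_ + _).
    by apply/eqP; rewrite eq_complex/= oppr0 !eqxx.
- exact: is_deck_comp.
- exact: is_deck_inv Dg.
Qed.

End DeckGroupForm.

(** * A single deck transformation: its differential and its action on curves *)

Section DeckForm.
Variable R : realType.
Local Notation C := R[i].
Variables (k : nat) (mu a b : R) (l : C) (h dh : C -> C) (g : C2 R -> C2 R).
Hypothesis gD : deck_form k mu a b l h dh g.

Let gE := deckE gD.

Lemma deck_s_of p : s_of (g p) = a * s_of p.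
Proof.
by rewrite gE /s_of /=; case: (p.1) => x y /=; rewrite mul0r subr0 addr0 mulrN.
Qed.

Lemma deck_Xcov p : Xcov p -> Xcov (g p).
Proof.
rewrite /Xcov /= => p0; rewrite -oppr_gt0 -/(s_of (g p)) deck_s_of.
by rewrite mulr_gt0 ?(deck_a_gt0 gD)// oppr_gt0.
Qed.

Definition deck_diff (p u : C2 R) : C2 R :=
  (a%:C * u.1, l * u.2 + dh p.1 * u.1).

Lemma deck_derive p u : 'D_u g p = deck_diff p u.
Proof.
apply: derive_val; apply/is_deriveP.
have [hh _] := deck_entire gD; have [phi [hE phic phiw]] := hh p.1.
(* With the slope [phi] of [h], the difference quotient of [g] is an exact expression for [e != 0],
   and only the continuity of [phi] is left to use. *)
have qE (e : C) : e != 0 ->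
    (a%:C * u.1, l * u.2 + phi (p.1 + e * u.1) * u.1) =
    e^-1 *: (g (e *: u + p) - g p).
  rewrite !gE => e0; case: u p hE {phic phiw} => [u1 u2] [p1 p2] /= hE.
  congr pair.
    have alg (x y z t : C) : x * y =
      e^-1 * ((x * (e * y + z) + t) - (x * z + t)).
      by field.
    exact: alg.
  have alg (x y z s t f f' : C) : f - f' = t * ((e * s + z) - z) ->
      x * y + t * s = e^-1 * ((x * (e * y + p2) + f) - (x * p2 + f')).
    move=> ff'; have -> : f = f' + t * (e * s) by rewrite -(subrK f' f) ff';
      ring.
    by field.
  by apply: alg; rewrite hE [p1 + _]addrC.
have {}qE : \forall e \near (0 : C^o)^',
    (a%:C * u.1, l * u.2 + phi (p.1 + e * u.1) * u.1) =
    e^-1 *: (g (e *: u + p) - g p).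
  by near=> e; apply: qE; near: e; exact: nbhs_dnbhs_neq.
apply: cvg_trans (near_eq_cvg qE) _.
apply: (@cvg_prod _ C^o C^o _ _ (fun=> a%:C * u.1) (fun e =>
  l * u.2 + phi (p.1 + e * u.1) * u.1) (a%:C * u.1) (l * u.2 + dh p.1 * u.1));
    apply: ccvg_limit.
  exact: ccvg_cst.
rewrite -phiw; apply: ccvgD; first exact: ccvg_cst.
apply: ccvgM; last exact: ccvg_cst.
have line_cvg (w x : C) : ccvg ((0 : C^o)^') (fun e : C => w + e * x) w.
  have : ccvg ((0 : C^o)^') (fun e : C => w + e * x) (w + 0 * x).
    apply: ccvgD; first exact: ccvg_cst.
    apply: ccvgM; last exact: ccvg_cst.
    by split; exact: cvg_within.
  by rewrite mul0r addr0.
exact: (ccvg_comp (line_cvg p.1 u.1) phic).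
Unshelve. all: by end_near. Qed.

Lemma deck_curve (c : R -> R4 R) (t : R) (v : R4 R) :
  is_derive t (1 : R) c v ->
  is_derive t (1 : R) (fun t => rpoint (g (Defs.cpoint (c t))))
    (rpoint (deck_diff (Defs.cpoint (c t)) (Defs.cpoint v))).
Proof.
move=> /is_derive_dcurve[w'E z'E]; apply/is_derive_dcurve.
rewrite !rpointK; under [X in dcurve X _ _ /\ _]eq_fun do rewrite rpointK gE.
under [X in _ /\ dcurve X _ _]eq_fun do rewrite rpointK gE.
split => /=.
  rewrite -[_ * _]addr0; apply: dcurveD; first exact: dcurveM.
  exact: dcurve_cst.
apply: dcurveD; first exact: dcurveM.
exact: dcurve_comp (deck_entire gD) w'E.
Qed.

End DeckForm.

(** * The form Theta *)

Section CanonicalForm.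
Variable R : realType.
Local Notation C := R[i].
Variables (k r : nat) (lam : C) (Q : {poly C}) (chi : C2 R -> R).
Local Notation Gam := (deck_group k r lam Q).
Local Notation mu := (mu_of k lam).
Hypotheses (k_ge2 : (2 <= k)%N) (lam_neq0 : lam != 0).
Hypothesis chiP : invariant_partition Gam chi.

Lemma open_Xcov : open (@Xcov R).
Proof.
rewrite openE => p p0.
have : Re \o fst @ p --> (Re p.1 : R^o).
  have /cvgCP[] // : ccvg (nbhs p) fst p.1.
  by split; exact: (@cvg_fst C^o C^o).
move=> /(_ [set x | x < 0]); apply.
by apply: open_nbhs_nbhs; split; [exact: open_lt|].
Qed.

(** Local finiteness replaces the sum over the infinite group, whose value would be the default 0 on
    an infinite support, by a sum over one list valid on a whole neighbourhood. Positivity and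
    continuity both rest on this. *)
Lemma averaged_metric_local p : Xcov p ->
  exists (U : set (C2 R)) (s : seq (C2 R -> C2 R)),
  [/\ nbhs p U, forall g, g \in s -> Gam g
    & forall x, U x -> [/\ Xcov x, \sum_(g <- s) chi (g x) = 1
      & forall u v, averaged_metric Gam chi x u v =
        \sum_(g <- s) (chi (g x))%:C * hdot ('D_u g x) ('D_v g x)]].
Proof.
move=> Xp; have [_ _ chi_fin chi1] := chiP.
have [V Vp finV] := chi_fin p Xp.
set D := [set g | _] in finV.
have [s0 Ds0] := (finite_seqP _).1 finV.
pose s := undup s0.
have sD g : (g \in s) = `[< D g >].
  rewrite mem_undup; apply/idP/asboolP => [gs|]; first by rewrite Ds0.
  by rewrite Ds0.
have sumE (W : nmodType) x (f : (C2 R -> C2 R) -> W) : (V `&` @Xcov R) x ->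
    (forall g, chi (g x) = 0 -> f g = 0) ->
    \sum_(g \in Gam) f g = \sum_(g <- s) f g.
  move=> Vx f0; rewrite [RHS]fsbig_seq ?undup_uniq//.
  symmetry; apply: (fsbig_widen [set` s] Gam); first by move=> g /=;
    rewrite sD => /asboolP[].
  move=> g [Gg /= gs]; apply: f0; apply/eqP; apply: contra_notT gs => chig.
  by rewrite sD; apply/asboolP; split=> //; exists x.
exists (V `&` @Xcov R), s; split.
- by apply: filterI => //; apply: open_nbhs_nbhs; split=> //; exact: open_Xcov.
- by move=> g; rewrite sD => /asboolP[].
move=> x Vx; split; first by case: Vx.
  by rewrite -(sumE _ x)//; apply: chi1; case: Vx.
by move=> u v; apply: sumE Vx _ => g ->; rewrite mul0r.
Qed.

Lemma Gam_deck g : Gam g -> is_deck k mu g.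
Proof. exact: deck_group_form. Qed.

Lemma hdot_deck a l dh p u z :
  hdot (deck_diff a l dh p u) (deck_diff a l dh p (0, z)) =
  (l * u.2 + dh p.1 * u.1) * (l * z)^*%C :> C.
Proof.
have alg (x y t w d : C) :
    x * (a%:C * 0)^*%C + y * (t * w + d * 0)^*%C = y * (t * w)^*%C.
  by rewrite !mulr0 addr0 (_ : 0^*%C = 0 :> C) ?mulr0 ?add0r//; exact: conjc0.
exact: alg.
Qed.

Lemma hdot_deck_dz a l dh p :
  hdot (deck_diff a l dh p (dz_dir R)) (deck_diff a l dh p (dz_dir R)) =
  l * l^*%C :> C.
Proof.
have alg (x : C) : (l * 1 + x * 0) * (l * 1)^*%C = l * l^*%C.
  by rewrite !mulr1 mulr0 addr0.
by rewrite /dz_dir hdot_deck; exact: alg.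
Qed.

Definition avg_wz p := averaged_metric Gam chi p (1, 0) (dz_dir R).
Definition avg_zz p := averaged_metric Gam chi p (dz_dir R) (dz_dir R).

(** Deck transformations preserve the vertical direction, so each term pairs only second components
    and is linear in [u]. Pairings with vertical vectors are all that the definition of [Theta]
    involves. *)
Lemma averaged_metricE p u z : Xcov p -> averaged_metric Gam chi p u (0, z) =
  (u.1 * avg_wz p + u.2 * avg_zz p) * z^*%C.
Proof.
move=> /averaged_metric_local[U [s [/nbhs_singleton Up sGam avgE]]].
have [_ _ {}avgE] := avgE _ Up.
rewrite /avg_wz /avg_zz !avgE !mulr_sumr -big_split/= mulr_suml.
rewrite big_seq [RHS]big_seq; apply: eq_bigr => g /sGam/Gam_deck.
move=> [a [b [l [h [dh gD]]]]]; rewrite !(deck_derive gD) /dz_dir !hdot_deck.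
by rewrite mulr1 rmorphM /=; ring.
Qed.

Lemma averaged_metric_dz p u : Xcov p ->
  averaged_metric Gam chi p u (dz_dir R) = u.1 * avg_wz p + u.2 * avg_zz p.
Proof.
move=> Xp; rewrite averaged_metricE//.
have alg (x : C) : x * 1^*%C = x by rewrite (_ : 1^*%C = 1 :> C) ?mulr1//;
  exact: conjc1.
exact: alg.
Qed.

(** Each term is [chi (g p) |l|^2 >= 0]. If the sum vanished, all [chi (g p)] would, although they
    add up to 1. *)
Lemma avg_zz_neq0 p : Xcov p -> avg_zz p != 0.
Proof.
move=> Xp; have [U [s [/nbhs_singleton Up sGam avgE]]]
  := averaged_metric_local Xp.
have [_ chi1 {}avgE] := avgE _ Up; have [_ chi_ge0 _ _] := chiP.
have sX g : g \in s -> 0 <= chi (g p).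
  move=> /sGam/Gam_deck[a [b [l [h [dh gD]]]]].
  by apply: chi_ge0; exact: deck_Xcov gD _ Xp.
rewrite /avg_zz avgE big_seq psumr_eq0; last first.
  move=> g gs; rewrite mulr_ge0 ?ler0c ?sX//.
  by rewrite /hdot addr_ge0// mulcJ_ge0.
apply/allP => chi0; move: chi1; rewrite big_seq big1; last first.
  move=> g gs; have := chi0 g gs; rewrite gs /= mulf_eq0.
  have [a [b [l [h [dh gD]]]]] := Gam_deck (sGam _ gs).
  rewrite (deck_derive gD) hdot_deck_dz mulf_eq0 conjc_eq0 orbb (negbTE
    (deck_l_neq0 gD)) orbF.
  by rewrite -[0]/(0%:C) (inj_eq (@complexI R)) => /eqP.
by move=> /esym/eqP; rewrite oner_eq0.
Qed.

(** The coefficient [B] of [Theta = dz + B dw]: the vector [(1, - B)] is orthogonal to the vertical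
    direction exactly when [avg_wz = B * avg_zz]. *)
Definition Bcoef p := avg_wz p / avg_zz p.

Lemma ThetaE (Theta : C2 R -> {linear C2 R -> R[i]^o}) p u :
  is_Theta Gam chi Theta -> Xcov p -> Theta p u = u.2 + Bcoef p * u.1.
Proof.
move=> ThetaP Xp; have [Th1 Th0] := ThetaP p Xp.
have uE : u = u.1 *: ((1, - Bcoef p) : C2 R) + (u.2 + Bcoef p * u.1) *: dz_dir
  R.
  case: u => [u1 u2]; congr pair.
    have alg (x y : C) : x = x * 1 + y * 0 by ring.
    exact: alg.
  have alg (x y z : C) : y = x * - z + (y + z * x) * 1 by ring.
  exact: alg.
have lin (c d : C) (v v' : C2 R) :
    Theta p (c *: v + d *: v') = c * Theta p v + d * Theta p v'.
  by rewrite linearD !linearZ.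
rewrite {1}uE lin Th1 Th0; last first.
  rewrite averaged_metric_dz//.
  have alg (x y : C) : y != 0 -> 1 * x + - (x / y) * y = 0.
    by move=> y0; rewrite mul1r mulNr divfK// subrr.
  by apply: alg; exact: avg_zz_neq0.
have alg (x y : C) : x * 0 + y * 1 = y by rewrite mulr0 mulr1 add0r.
exact: alg.
Qed.

(** Composition on the right with [g] permutes the group, and the chain rule turns the term of [f]
    at [g p] into that of [f \o g] at [p]. *)
Lemma averaged_metric_invariant g a b l h dh p u v : Gam g ->
  deck_form k mu a b l h dh g ->
  averaged_metric Gam chi (g p) (deck_diff a l dh p u) (deck_diff a l dh p v) =
  averaged_metric Gam chi p u v.
Proof.
move=> Gg gD; have [g' gK g'K] := is_deck_bij (Gam_deck Gg).
have Gg' : Gam g' by exact: generated_inv Gg gK g'K.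
rewrite [in RHS]/averaged_metric.
rewrite [RHS](reindex_fsbig (fun f : C2 R -> C2 R => f \o g) Gam Gam);
  last first.
  split=> [f Gf|f f' _ _ ff'|f Gf].
  - exact: generated_comp.
  - apply/funext => x; rewrite -(g'K x).
    exact: (congr1 (fun F => F (g' x)) ff').
  - exists (f \o g'); first exact: generated_comp.
    by apply/funext => x /=; rewrite gK.
apply: eq_fsbigr => f; rewrite inE => /Gam_deck[a' [b' [l' [h' [dh' fD]]]]].
rewrite !(deck_derive fD) !(deck_derive (deck_form_comp fD gD)).
rewrite /deck_diff /= (deckE gD p) /=; congr (_ * _); congr hdot; congr pair.
- by rewrite mulrA rmorphM.
- by ring.
- by rewrite mulrA rmorphM.
- by ring.
Qed.

(** The [dw] coefficient of [g^* Theta = l Theta]. Since the vertical vector is sent to its multiple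
    by [l], invariance of the metric gives both averages at [p] from those at [g p], and the
    conjugate of [l] cancels in their ratio. *)
Lemma Bcoef_deck g a b l h dh p : Gam g -> deck_form k mu a b l h dh g ->
  Xcov p -> dh p.1 + Bcoef (g p) * a%:C = l * Bcoef p.
Proof.
move=> Gg gD Xp; have Xgp := deck_Xcov gD Xp; have l0 := deck_l_neq0 gD.
have zE u : averaged_metric Gam chi p u (dz_dir R) =
    (a%:C * u.1 * avg_wz (g p) + (l * u.2 + dh p.1 * u.1) * avg_zz (g p)) *
      l^*%C.
  rewrite -(averaged_metric_invariant p u (dz_dir R) Gg gD).
  by rewrite {2}/deck_diff /dz_dir /= mulr0 mulr0 addr0 mulr1 averaged_metricE.
have := zE (dz_dir R); have := zE (1, 0).
rewrite -/(avg_wz p) -/(avg_zz p) /= !mulr0 !mulr1 add0r mul0r add0r addr0.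
rewrite /Bcoef => -> ->; have := avg_zz_neq0 Xgp => zN0.
have lJ : l^*%C != 0 by rewrite conjc_eq0.
by field; rewrite l0 zN0 lJ.
Qed.

Lemma Theta_deck (Theta : C2 R -> {linear C2 R -> R[i]^o}) g a b l h dh p u :
  is_Theta Gam chi Theta -> Gam g -> deck_form k mu a b l h dh g -> Xcov p ->
  Theta (g p) (deck_diff a l dh p u) = l * Theta p u.
Proof.
move=> ThetaP Gg gD Xp; rewrite !ThetaE//; last exact: deck_Xcov gD _ Xp.
rewrite /deck_diff /= [RHS]mulrDr [l * (Bcoef p * _)]mulrA -(Bcoef_deck Gg gD
  Xp).
have alg (x y z t s : C) : x + z * t + y * (s * t) =
  x + (z + y * s) * t by ring.
exact: alg.
Qed.

Lemma deck_continuous g a b l h dh p : deck_form k mu a b l h dh g ->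
  {for p, continuous g}.
Proof.
move=> gD; rewrite /prop_for /continuous_at.
have -> : g = fun p => (a%:C * p.1 + 0 +i* b, l * p.2 + h p.1).
  by apply/funext => x; rewrite (deckE gD).
have p1 : ccvg (nbhs p) fst p.1 by split; exact: (@cvg_fst C^o C^o).
have p2 : ccvg (nbhs p) snd p.2 by split; exact: (@cvg_snd C^o C^o).
apply: (@cvg_prod _ C^o C^o); apply: ccvg_limit; apply: ccvgD.
- by apply: ccvgM => //; exact: ccvg_cst.
- exact: ccvg_cst.
- by apply: ccvgM => //; exact: ccvg_cst.
- exact: ccvg_comp p1 (entire_continuous (deck_entire gD) _).
Qed.

Lemma ccvg_sum (I : eqType) (s : seq I) (T : Type) (F : set_system T)
    {FF : Filter F} (f : I -> T -> C) (z : I -> C) :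
  (forall i, i \in s -> ccvg F (f i) (z i)) ->
  ccvg F (fun t => \sum_(i <- s) f i t) (\sum_(i <- s) z i).
Proof.
elim: s => [|i s IH] fz.
  rewrite big_nil; apply: ccvg_near (ccvg_cst 0).
  by apply: nearW => t; rewrite big_nil.
rewrite big_cons; apply: (@ccvg_near _ _ _ _ (fun t =>
  f i t + \sum_(j <- s) f j t)).
  by apply: nearW => t; rewrite big_cons.
apply: ccvgD; first by apply: fz; rewrite mem_head.
by apply: IH => j js; apply: fz; rewrite in_cons js orbT.
Qed.

(** Serves twice: for the continuity of the integrand of lengths, and for the boundedness of [B] on
    compact boxes. *)
Lemma Bcoef_continuous p : Xcov p -> ccvg (nbhs p) Bcoef (Bcoef p).
Proof.
move=> Xp; have [U [s [Up sGam avgE]]] := averaged_metric_local Xp.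
have [smooth_chi _ _ _] := chiP; have [chi_cont _] := smooth_chi 0.
have p1 : ccvg (nbhs p) fst p.1 by split; exact: (@cvg_fst C^o C^o).
have avg_cvg u : ccvg (nbhs p)
    (fun x => averaged_metric Gam chi x u (dz_dir R))
    (averaged_metric Gam chi p u (dz_dir R)).
  have [_ _ pE] := avgE _ (nbhs_singleton Up).
  apply: (@ccvg_near _ _ _ _ (fun x => \sum_(g <- s) (chi (g x))%:C *
      hdot ('D_u g x) ('D_(dz_dir R) g x))).
    by apply: filterS Up => x /avgE[_ _ ->].
  rewrite pE; apply: ccvg_sum => g /sGam/Gam_deck[a [b [l [h [dh gD]]]]].
  apply: ccvgM.
    apply: ccvg_real.
    apply: (@continuous_comp _ _ _ g chi); first exact: deck_continuous gD.
    by apply: chi_cont; exact: deck_Xcov gD _ Xp.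
  rewrite (deck_derive gD) (deck_derive gD p (dz_dir R)).
  apply: (@ccvg_near _ _ _ _ (fun x : C2 R =>
    (l * u.2 + dh x.1 * u.1) * l^*%C)).
    by apply: nearW => x; rewrite !(deck_derive gD) /dz_dir hdot_deck mulr1.
  rewrite /dz_dir hdot_deck mulr1.
  apply: ccvgM; last exact: ccvg_cst.
  apply: ccvgD; first exact: ccvg_cst.
  apply: ccvgM; last exact: ccvg_cst.
  by apply: ccvg_comp p1 _; have [_] := deck_entire gD; exact.
apply: ccvgM; first exact: avg_cvg.
by apply: ccvgV; [exact: avg_zz_neq0|exact: avg_cvg].
Qed.

End CanonicalForm.

(** * The metric Omega_t *)

Section Metric.
Variable R : realType.
Local Notation C := R[i].
Variables (mu M : R) (Theta : C2 R -> {linear C2 R -> R[i]^o}) (t : R).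
Local Notation At := (A_of mu M t).

Lemma i_wedge_conj_J (f : {linear C2 R -> R[i]^o}) (u : C2 R) :
  i_wedge_conj f u ('i%C *: u) = (2 * cabs (f u) ^+ 2)%:C.
Proof.
have fZ : f ('i%C *: u) = 'i%C * f u :> C by exact: linearZ.
rewrite /i_wedge_conj fZ cabs_sqr.
case: (f u) => x y; apply/eqP; rewrite eq_complex /=.
by apply/andP; split; apply/eqP; ring.
Qed.

(** A form [i a /\ conj a] has squared norm [2 |a|^2]; applied to [omega_tr], this turns
    [1 / (4 s^2)] into [1 / (2 s^2)]. *)
Lemma riem_normE (p u : C2 R) : riem_norm (Omega mu M Theta t) p u =
  Num.sqrt (At / (2 * s_of p ^+ 2) * cabs u.1 ^+ 2 +
    2 * (expR (- t) * s_of p `^ mu) * cabs (Theta p u) ^+ 2).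
Proof.
rewrite /riem_norm /Omega i_wedge_conj_J /omega_tr.
have -> : i_wedge_conj fst u ('i%C *: u) = (2 * cabs u.1 ^+ 2)%:C.
  rewrite /i_wedge_conj cabs_sqr -[('i%C *: u).1]/('i%C * u.1).
  case: (u.1) => x y; apply/eqP; rewrite eq_complex /=.
  by apply/andP; split; apply/eqP; ring.
rewrite -!rmorphM -rmorphD /=; congr Num.sqrt.
(* For [s = 0] the identity holds because the inverse of 0 is 0. *)
have [->|s0] := eqVneq (s_of p) 0; last by field.
by rewrite expr0n/= !mulr0 invr0; ring.
Qed.

End Metric.

Lemma convex_between (R : realFieldType) (lo hi u v e : R) :
  0 <= e <= 1 -> lo <= u <= hi -> lo <= v <= hi ->
  lo <= u + e * (v - u) <= hi.
Proof. by move=> ? ? ?; nra. Qed.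

Section CPoint.
Variable R : realType.
Local Notation C := R[i].

Lemma ccvg_cpoint (T : Type) (F : set_system T) {FF : Filter F}
    (c : T -> R4 R) (x : R4 R) : c @ F --> x ->
  ccvg F (fun t => (Defs.cpoint (c t)).1) (Defs.cpoint x).1 /\
  ccvg F (fun t => (Defs.cpoint (c t)).2) (Defs.cpoint x).2.
Proof.
move=> cx; have cpx : @Defs.cpoint R \o c @ F --> Defs.cpoint x.
  by apply: (@continuous_cvg _ _ _ _ _ _ (@Defs.cpoint R) _ _ cx);
    exact: cpoint_continuous.
split; split.
- apply: (@continuous_cvg _ (C2 R) C^o _ _ _ fst _ _ cpx); exact: cvg_fst.
- apply: (@continuous_cvg _ (C2 R) C^o _ _ _ snd _ _ cpx); exact: cvg_snd.
Qed.

Lemma rpoint_cvg (T : Type) (F : set_system T) {FF : Filter F}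
    (f g : T -> C) (w z : C) : ccvg F f w -> ccvg F g z ->
  (fun t => rpoint (f t, g t)) @ F --> rpoint (w, z).
Proof.
move=> /cvgCP[f1 f2] /cvgCP[g1 g2].
by apply: cvg_prod; apply: cvg_prod.
Qed.

Lemma curve_continuous (E : normedModType R) (U : set E) (c : R -> E) (t : R) :
  C1_piece U c -> {for t, continuous c}.
Proof.
by move=> [dc _ _]; apply: differentiable_continuous; apply/derivable1_diffP.
Qed.

Lemma curve_is_derive (E : normedModType R) (U : set E) (c : R -> E) (t : R) :
  C1_piece U c -> is_derive t (1 : R) c (derive1 c t).
Proof. by move=> [dc _ _]; rewrite derive1E; apply/derivableP. Qed.

Lemma is_derive_pair (V W : normedModType R) (f : R -> V) (g : R -> W) (t : R)
    (a : V) (b : W) : is_derive t (1 : R) f a -> is_derive t (1 : R) g b ->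
  is_derive t (1 : R) (fun t => (f t, g t)) (a, b).
Proof. by move=> /is_deriveP fa /is_deriveP gb; apply/is_deriveP;
  exact: cvg_prod. Qed.

Lemma is_derive_fst (V W : normedModType R) (f : R ->
  V * W) (t : R) (v : V * W) :
  is_derive t (1 : R) f v -> is_derive t (1 : R) (fun t => (f t).1) v.1.
Proof.
move=> /is_deriveP fv; apply/is_deriveP.
by apply: (@continuous_cvg _ _ _ _ _ _ fst _ _ fv); exact: cvg_fst.
Qed.

Lemma C1_pieceP (E : normedModType R) (U : set E) (c dc : R -> E) :
  (forall t : R, is_derive t (1 : R) c (dc t)) -> continuous dc ->
  (forall t, 0 <= t <= 1 -> U (c t)) -> C1_piece U c /\ derive1 c = dc.
Proof.
move=> cE dcc Uc; have dcE : derive1 c = dc.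
  by apply/funext => t; rewrite derive1E;
    exact: (@derive_val _ _ _ _ _ _ _ (cE t)).
rewrite -dcE in dcc; split=> //; split=> // t.
Qed.

End CPoint.

(** * The distance [d_t]: pseudometric property and two-sided estimates *)

Section QuotientMetric.
Variable R : realType.
Local Notation C := R[i].
Variables (S : Type) (k r : nat) (lam : C) (Q : {poly C}) (q : C2 R -> S).
Variables (chi : C2 R -> R) (Theta : C2 R -> {linear C2 R -> R[i]^o}).
Variables (M t : R).
Local Notation Gam := (deck_group k r lam Q).
Local Notation mu := (mu_of k lam).
Hypotheses (k_ge2 : (2 <= k)%N) (lam_neq0 : lam != 0).
Hypothesis chiP : invariant_partition Gam chi.
Hypothesis ThetaP : is_Theta Gam chi Theta.
Hypothesis q_eq : forall p p', Xcov p -> Xcov p' ->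
  q p = q p' <-> exists2 g, Gam g & p' = g p.
Local Notation At := (A_of mu M t).
Hypothesis A_ge0 : 0 <= At.

Local Notation U := (@Defs.cpoint R @^-1` @Xcov R).
Local Notation qc := (q \o @Defs.cpoint R).
Local Notation F := (fun x v : R4 R =>
  riem_norm (Omega mu M Theta t) (Defs.cpoint x) (Defs.cpoint v)).

Lemma metric_ge0 x v : 0 <= F x v.
Proof. exact: sqrtr_ge0. Qed.

Lemma metric_opp x v : F x (- v) = F x v.
Proof.
have -> : Defs.cpoint (- v) = - Defs.cpoint v by case: v => [[? ?] [? ?]].
have cabsN (z : C) : cabs (- z) = cabs z by exact: normcN.
rewrite !riem_normE; congr Num.sqrt; congr (_ * _ ^+ 2 + _ * _ ^+ 2).
  exact: cabsN.
by rewrite linearN; exact: cabsN.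
Qed.

Lemma metricE x v : U x -> F x v =
  Num.sqrt (At / (2 * s_of (Defs.cpoint x) ^+ 2) * cabs (Defs.cpoint v).1 ^+ 2 +
    2 * (expR (- t) * expR (mu * ln (s_of (Defs.cpoint x)))) *
    cabs ((Defs.cpoint v).2 + Bcoef k r lam Q chi (Defs.cpoint x) *
      (Defs.cpoint v).1) ^+ 2).
Proof.
move=> Ux /=; rewrite riem_normE (ThetaE k_ge2 lam_neq0 chiP _ ThetaP Ux) /powR
  gt_eqF//.
by rewrite /s_of oppr_gt0.
Qed.

Lemma metric_continuous c : C1_piece U c ->
  {within `[0%R, 1%R], continuous (fun x : R => F (c x) (derive1 c x))}.
Proof.
move=> C1c; have [_ dcc Uc] := C1c.
pose G (x v : R4 R) := Num.sqrt (At / (2 * s_of (Defs.cpoint x) ^+ 2) *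
  cabs (Defs.cpoint v).1 ^+ 2 +
    2 * (expR (- t) * expR (mu * ln (s_of (Defs.cpoint x)))) *
    cabs ((Defs.cpoint v).2 + Bcoef k r lam Q chi (Defs.cpoint x) *
      (Defs.cpoint v).1) ^+ 2).
apply: (@subspace_eq_continuous _ _ _ (fun x : R => G (c x) (derive1 c x))).
  move=> x; rewrite inE /= in_itv/= => x01; symmetry; apply: metricE; exact: Uc.
apply: continuous_in_subspaceT => x; rewrite inE /= in_itv/= => /Uc Ux.
have cx : {for x, continuous c} := curve_continuous C1c.
have dcx := dcc x.
have [w z] := ccvg_cpoint cx; have [w' z'] := ccvg_cpoint dcx.
have s0 : 0 < s_of (Defs.cpoint (c x)) by rewrite /s_of oppr_gt0.
have sc : (fun x => s_of (Defs.cpoint (c x))) @ x --> (s_of (Defs.cpoint (c x))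
  : R^o).
  by have /cvgCP[wR _] := w; exact: (@cvgN R R^o).
have Bc : ccvg (nbhs x) (fun x => Bcoef k r lam Q chi (Defs.cpoint (c x)))
    (Bcoef k r lam Q chi (Defs.cpoint (c x))).
  split; apply: (@continuous_comp R (C2 R) C^o (@Defs.cpoint R \o c) (Bcoef k r
    lam Q chi)).
    by apply: continuous_comp; [exact: cx|exact: cpoint_continuous].
  by have [] := Bcoef_continuous k_ge2 lam_neq0 chiP Ux.
have sqr_cvg (f : R -> R) : f @ x --> (f x : R^o) -> (fun x =>
  f x ^+ 2) @ x --> (f x ^+ 2 : R^o).
  by move=> fx; rewrite expr2; under eq_fun do rewrite expr2; exact: cvgM.
apply: (@continuous_cvg _ _ _ _ _ _ (@Num.sqrt R));
  first exact: sqrt_continuous.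
apply: (@cvgD R R^o); apply: cvgM.
- apply: cvgM; first exact: cvg_cst.
  apply: cvgV; first by rewrite mulf_neq0// expf_neq0// gt_eqF.
  by apply: cvgM; [exact: cvg_cst|exact: sqr_cvg].
- by apply: sqr_cvg; exact: cvg_cabs w'.
- apply: cvgM; first exact: cvg_cst.
  apply: cvgM; first exact: cvg_cst.
  apply: (@continuous_cvg _ _ _ _ _ _ (@expR R)); first exact: continuous_expR.
  apply: cvgM; first exact: cvg_cst.
  by apply: (@continuous_cvg _ _ _ _ _ _ (@ln R) _ _ sc); exact: continuous_ln.
- apply: sqr_cvg; apply: (@cvg_cabs _ _ _ _ (fun x => _ + _)).
  by apply: ccvgD => //; exact: ccvgM.
Qed.

(** Deck transformations are isometries: [|dw|] and [s] are both multiplied by [a], [|Theta|] by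
    [|l|], and [s ^ mu] by [a ^ mu]. *)
Lemma deck_lift x x' : U x -> U x' -> qc x = qc x' ->
  exists g : R4 R -> R4 R, [/\ g x = x', forall y,
    U y -> U (g y) /\ qc (g y) = qc y
    & forall c, C1_piece U c -> C1_piece U (g \o c) /\
      forall t, 0 <= t <= 1 ->
        F (g (c t)) (derive1 (g \o c) t) = F (c t) (derive1 c t)].
Proof.
move=> Ux Ux' /(q_eq Ux Ux')[g Gg gx].
have [a [b [l [h [dh gD]]]]] := deck_group_form k_ge2 lam_neq0 Gg.
exists (fun y => rpoint (g (Defs.cpoint y))); split.
- by rewrite -gx cpointK.
- move=> y Uy; have Xgy := deck_Xcov gD Uy.
  rewrite /= rpointK; split=> //; apply/esym/q_eq => //.
  by exists g.
move=> c C1c; have [dc dcc Uc] := C1c.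
pose gc e := rpoint (g (Defs.cpoint (c e))).
pose dgc e := rpoint (deck_diff a l dh (Defs.cpoint (c e)) (Defs.cpoint
  (derive1 c e))).
have gcE (e : R) : is_derive e (1 : R) gc (dgc e).
  refine (deck_curve gD (@curve_is_derive _ _ _ _ e C1c)).
have dgcc : continuous dgc.
  move=> x0; have cx : {for x0, continuous c} := curve_continuous C1c.
  have [w z] := ccvg_cpoint cx; have [w' z'] := ccvg_cpoint (dcc x0).
  apply: rpoint_cvg; first by apply: ccvgM => //; exact: ccvg_cst.
  apply: ccvgD; first by apply: ccvgM => //; exact: ccvg_cst.
  apply: ccvgM => //; apply: ccvg_comp w _.
  by have [_] := deck_entire gD; exact.
have Ugc e : 0 <= e <= 1 -> U (gc e).
  by move=> e01; rewrite /= rpointK; apply: (deck_Xcov gD); exact: Uc.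
have [C1gc dgcE] := C1_pieceP gcE dgcc Ugc.
split; first exact: C1gc.
move=> s s01; have Us := Uc _ s01.
have -> : F (rpoint (g (Defs.cpoint (c s)))) (derive1 gc s) = F (gc s) (dgc s).
  by rewrite dgcE.
rewrite /gc /dgc /= !rpointK !riem_normE; congr Num.sqrt.
rewrite (Theta_deck k_ge2 lam_neq0 chiP _ ThetaP Gg gD Us) (deck_s_of gD).
have a0 := deck_a_gt0 gD; have l0 := cabs_gt0 (deck_l_neq0 gD).
have s0 : 0 < s_of (Defs.cpoint (c s)) by rewrite /s_of oppr_gt0.
rewrite /deck_diff [cabs (_ * (Defs.cpoint _).1)]cabsM [cabs (l * _)]cabsM.
have -> : cabs a%:C = a by rewrite cabsE /= expr0n addr0 sqrtr_sqr gtr0_norm.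
rewrite powRM ?ltW// !exprMn; congr (_ + _); first by field; rewrite !gt_eqF.
(* This is [deck_mu] after exponentiation. *)
have -> : a `^ mu = (cabs l ^+ 2)^-1.
  rewrite /powR gt_eqF// -(lnK l0) -expRM_natl -expRN; congr expR.
  by apply/eqP; rewrite -subr_eq0 opprK (deck_mu gD).
by field; rewrite !gt_eqF.
Qed.

Section ConnectingPath.
Variables x y : R4 R.
Hypotheses (Ux : U x) (Uy : U y).
Local Notation lns z := (ln (- z.1.1)).

(* The parametrisation makes [ds / s] constant. *)
Definition connecting_path (e : R) : R4 R :=
  ((- expR (lns x + e * (lns y - lns x)), x.1.2 + e * (y.1.2 - x.1.2)),
   (x.2.1 + e * (y.2.1 - x.2.1), x.2.2 + e * (y.2.2 - x.2.2))).

Definition connecting_velocity (e : R) : R4 R :=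
  ((- (expR (lns x + e * (lns y - lns x)) * (lns y - lns x)), y.1.2 - x.1.2),
   (y.2.1 - x.2.1, y.2.2 - x.2.2)).

Lemma connecting_path0 : connecting_path 0 = x.
Proof.
rewrite /connecting_path !mul0r !addr0 lnK ?posrE ?oppr_gt0// opprK.
by case: (x) => [[? ?] [? ?]].
Qed.

Lemma connecting_path1 : connecting_path 1 = y.
Proof.
rewrite /connecting_path !mul1r ![_ + (_ - _)]addrC !subrK.
rewrite lnK ?posrE ?oppr_gt0// opprK.
by case: (y) => [[? ?] [? ?]].
Qed.

Lemma connecting_path_C1 : C1_piece U connecting_path /\
  derive1 connecting_path = connecting_velocity.
Proof.
have affine (u v e : R) : is_derive e (1 : R) (fun e : R => u + e * v) v.
  rewrite -[X in is_derive _ _ _ X]add0r; apply: is_deriveD.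
  by apply: is_derive_eq; rewrite scaler0 add0r [_ *: _]mulr1.
apply: C1_pieceP => [e|e|e _].
- apply: is_derive_pair; apply: is_derive_pair => //.
- apply: cvg_prod; apply: cvg_prod; try exact: cvg_cst.
  apply: (@cvgN R R^o); apply: cvgM; last exact: cvg_cst.
  apply: (@continuous_cvg _ _ _ _ _ _ (@expR R)); first exact: continuous_expR.
  apply: (@cvgD R R^o); first exact: cvg_cst.
  by apply: cvgM; [exact: cvg_id|exact: cvg_cst].
- by rewrite /= /Xcov /= oppr_lt0 expR_gt0.
Qed.

End ConnectingPath.

Lemma U_path x y : U x -> U y -> exists cs, path_from_to U cs x y.
Proof.
move=> Ux Uy; have [C1c _] := connecting_path_C1 x y.
exists [:: connecting_path x y]; split=> //; first exact: connecting_path0.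
by rewrite /= connecting_path1.
Qed.

Local Notation dist := (dist_t q mu M Theta t).

Lemma dist_t_pseudometric : pseudometric_on (q @` @Xcov R) dist.
Proof.
have img p : Xcov p -> U (rpoint p) /\ qc (rpoint p) = q p.
  by move=> Xp; rewrite /= rpointK.
split=> [_ [p Xp <-]|_ _ [p Xp <-] [p' Xp' <-]|_ _ _ [p Xp <-] [p' Xp' <-]
  [p'' Xp'' <-]].
- have [Up <-] := img p Xp; exact: (length_dist_xx qc metric_ge0 Up).
- have [Up <-] := img p Xp; have [Up' <-] := img p' Xp'.
  exact: (length_dist_sym qc metric_ge0 metric_continuous metric_opp U_path Up
    Up').
- have [Up <-] := img p Xp; have [Up' <-] := img p' Xp';
  have [Up'' <-] := img p'' Xp''.
  exact: (length_dist_triangle metric_ge0 U_path deck_lift Up Up' Up'').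
Qed.

(** Calibration by [sqrt (A / 2) * ln s]: its differential only sees [ds / s], and the squared norm
    is at least [A / 2 * |dw|^2 / s^2]. All lifts occur in the hypothesis because the competing
    paths may join any of them. *)
Lemma dist_t_ge l x y : U x -> U y ->
  (forall x' y', U x' -> U y' -> qc x' = qc x -> qc y' = qc y ->
    l <= Num.sqrt (At / 2) * `|ln (- y'.1.1) - ln (- x'.1.1)|) ->
  l <= dist (qc x) (qc y).
Proof.
move=> Ux Uy Hl; have [cs pcs] := U_path Ux Uy.
apply: (length_dist_ge pcs) => cs' x' y' pcs' qx' qy'.
have [Ux' Uy'] := path_endpoints pcs'.
apply: le_trans (Hl _ _ Ux' Uy' qx' qy') _.
rewrite -[Num.sqrt (At / 2)]ger0_norm ?sqrtr_ge0// -normrM mulrBr.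
apply: (path_length_ge (L := fun x => Num.sqrt (At / 2) * ln (- x.1.1))
  (dL := fun x v => Num.sqrt (At / 2) * (v.1.1 / x.1.1)) metric_continuous _ _
    pcs').
- move=> c C1c; have [_ dcc Uc] := C1c.
  split.
    apply: continuous_in_subspaceT => e; rewrite inE /= in_itv/= => /Uc Ue.
    have ce : {for e, continuous c} := curve_continuous C1c.
    have [/cvgCP[w _] _] := ccvg_cpoint ce.
    have [/cvgCP[w' _] _] := ccvg_cpoint (dcc e).
    apply: cvgM; first exact: cvg_cst.
    apply: cvgM; first exact: w'.
    by apply: cvgV; [rewrite lt_eqF|exact: w].
  move=> e /Uc Ue; have ce := @curve_is_derive _ _ _ _ e C1c.
  have c11 := is_derive_fst (is_derive_fst ce).
  have cN : is_derive e (1 : R) (fun e : R =>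
    - (c e).1.1) (- (derive1 c e).1.1).
    exact: is_deriveN.
  have Ne : 0 < - (c e).1.1 by rewrite oppr_gt0.
  have cln : is_derive e (1 : R) (fun e : R => ln (- (c e).1.1))
      ((- (c e).1.1)^-1 * - (derive1 c e).1.1).
    exact: (is_derive1_comp (g := fun e : R =>
      - (c e).1.1) (is_derive1_ln Ne) cN).
  have -> : Num.sqrt (At / 2) * ((derive1 c e).1.1 / (c e).1.1) =
      Num.sqrt (At / 2) *: ((- (c e).1.1)^-1 * - (derive1 c e).1.1 : R^o).
    by rewrite invrN mulrNN [_^-1 * _]mulrC.
  exact: (is_deriveZ (Num.sqrt (At / 2)) cln).
- move=> z v Uz; rewrite (metricE _ Uz) -sqrtr_sqr; apply: ler_wsqrtr.
  rewrite -[leLHS]addr0; apply: lerD; last first.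
    by rewrite mulr_ge0 ?sqr_ge0// mulr_ge0// mulr_ge0 ?expR_ge0.
  rewrite exprMn sqr_sqrtr ?divr_ge0//.
  have zN0 : z.1.1 != 0 by rewrite lt_eqF.
  have -> : At / (2 * s_of (Defs.cpoint z) ^+ 2) * cabs (Defs.cpoint v).1 ^+ 2 =
      At / 2 * (cabs (Defs.cpoint v).1 ^+ 2 / z.1.1 ^+ 2).
    by rewrite /s_of /=; field.
  rewrite ler_wpM2l ?divr_ge0// expr_div_n ler_wpM2r ?invr_ge0 ?sqr_ge0//.
  by rewrite cabs_sqr /= lerDl sqr_ge0.
Qed.

Definition real_box (a b c d : R) : set (R4 R) :=
  [set x | [/\ a <= - x.1.1 <= b, `|x.1.2| <= c,
    `|x.2.1| <= d & `|x.2.2| <= d]].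

(** The connecting path stays in the box and has [|ds| / s = |L|] and [1 / s <= 1 / a], whence the
    first term. In the second, [s ^ mu <= b ^ mu]; [4 * d] bounds [|dz|], each of its two
    coordinates varying by at most [2 * d]; and [b * (ln b - ln a) + 2 * c] bounds [|dw|], which [K]
    weighs in [Theta = dz + B dw]. *)
Lemma dist_t_le a b c d K x y : 0 < a -> 0 <= mu -> 0 <= K ->
  (forall z, real_box a b c d z ->
    cabs (Bcoef k r lam Q chi (Defs.cpoint z)) <= K) ->
  real_box a b c d x -> real_box a b c d y ->
  dist (qc x) (qc y) <= Num.sqrt (At / 2) *
      (`|ln (- y.1.1) - ln (- x.1.1)| + `|y.1.2 - x.1.2| / a) +
    Num.sqrt (expR (- t)) * (Num.sqrt (2 * expR (mu * ln b)) *
      (4 * d + K * (b * (ln b - ln a) + 2 * c))).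
Proof.
move=> a0 mu0 K0 BK Bx By.
have [/andP[ax xb] x12 x21 x22] := Bx; have [/andP[ay yb] y12 y21 y22] := By.
have x0 : 0 < - x.1.1 by exact: lt_le_trans ax.
have y0 : 0 < - y.1.1 by exact: lt_le_trans ay.
have Ux : U x by rewrite /= /Xcov /= -oppr_gt0.
have Uy : U y by rewrite /= /Xcov /= -oppr_gt0.
have b0 : 0 < b by exact: lt_le_trans xb.
have [C1c cE] := connecting_path_C1 x y.
set bound := (X in _ <= X).
suff H (e : R) : 0 <= e <= 1 ->
    F (connecting_path x y e) (derive1 (connecting_path x y) e) <= bound.
  have := length_dist_segment qc metric_ge0 metric_continuous C1c H.
  by rewrite connecting_path0// connecting_path1//; exact.
move=> e01; rewrite /bound.
have Uc : U (connecting_path x y e) by have [_ _] := C1c; exact.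
have lx : ln a <= ln (- x.1.1) <= ln b by rewrite !ler_ln ?posrE// ax.
have ly : ln a <= ln (- y.1.1) <= ln b by rewrite !ler_ln ?posrE// ay.
have ls := convex_between e01 lx ly.
have Bc : real_box a b c d (connecting_path x y e).
  have norm_conv (u v m : R) : `|u| <= m -> `|v| <= m ->
    `|u + e * (v - u)| <= m.
    by rewrite !ler_norml => ? ?; exact: convex_between.
  split; [|exact: norm_conv..].
  have la : expR (ln a) = a by rewrite lnK.
  have lb : expR (ln b) = b by rewrite lnK.
  rewrite /= opprK; case/andP: ls => lsa lsb.
  by apply/andP; split; [rewrite -[leLHS]la|rewrite -[leRHS]lb];
    rewrite ler_expR.
have BleK := BK _ Bc; rewrite cE (metricE _ Uc).
set wv := (Defs.cpoint (connecting_velocity x y e)).1.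
set zv := (Defs.cpoint (connecting_velocity x y e)).2.
pose s := expR (ln (- x.1.1) + e * (ln (- y.1.1) - ln (- x.1.1))).
have -> : s_of (Defs.cpoint (connecting_path x y e)) =
  s by rewrite /s_of /= opprK.
set B := Bcoef _ _ _ _ _ _ in BleK *.
set L := ln (- y.1.1) - ln (- x.1.1).
have s0 : 0 < s := expR_gt0 _.
have /andP[as_ sb] : a <= s <= b by case: Bc; rewrite /= opprK.
have wle : cabs wv <= s * `|L| + `|y.1.2 - x.1.2|.
  by apply: le_trans (cabs_le _) _; rewrite /= normrN normrM gtr0_norm.
have zle : cabs zv <= 4 * d.
  apply: le_trans (cabs_le _) _; rewrite /=.
  have n1 := ler_normB y.2.1 x.2.1; have n2 := ler_normB y.2.2 x.2.2.
  by lra.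
(* Separates the transverse part, which survives in the limit, from the part of [Theta], which
   carries the factor [e^(-t/2)]. *)
have sqrt_le (X Y P P' : R) : 0 <= P -> 0 <= P' -> X <= P ^+ 2 ->
  Y <= P' ^+ 2 ->
    Num.sqrt (X + Y) <= P + P'.
  move=> P0 P'0 XP YP; rewrite -[leRHS]ger0_norm ?addr_ge0// -sqrtr_sqr.
  by apply: ler_wsqrtr; rewrite sqrrD; have PP := mulr_ge0 P0 P'0;
    rewrite -mulr_natr; lra.
have c0 : 0 <= c by exact: le_trans x12.
have d0 : 0 <= d by exact: le_trans x21.
have lab : ln a <= ln b by case/andP: lx => /le_trans; apply.
have LE : `|L| <= ln b - ln a by rewrite ler_norml /L; lra.
have thE : `|y.1.2 - x.1.2| <= 2 * c.
  by have n1 := ler_normB y.1.2 x.1.2; lra.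
have wle' : cabs wv <= b * (ln b - ln a) + 2 * c.
  apply: le_trans wle _; apply: lerD => //.
  by apply: ler_pM => //; exact: ltW.
have ba0 : 0 <= b * (ln b - ln a) + 2 * c.
  by apply: le_trans wle'; exact: cabs_ge0.
apply: sqrt_le.
- by rewrite mulr_ge0 ?sqrtr_ge0// addr_ge0// divr_ge0// ltW.
- rewrite !mulr_ge0 ?sqrtr_ge0// addr_ge0 ?mulr_ge0//.
- move: (cabs wv) (cabs_ge0 wv) wle wle' => w w0 wle wle'.
  rewrite exprMn sqr_sqrtr ?divr_ge0//.
  have -> : At / (2 * s ^+ 2) * w ^+ 2 = At / 2 * (w / s) ^+ 2.
    by field; rewrite gt_eqF.
  rewrite ler_wpM2l ?divr_ge0//.
  have ws : w / s <= `|L| + `|y.1.2 - x.1.2| / a.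
    rewrite ler_pdivrMr// mulrDl [`|L| * s]mulrC; apply: le_trans wle _.
    rewrite lerD2l -mulrA ler_peMr// mulrC ler_pdivlMr// mul1r//.
  by rewrite ler_sqr ?nnegrE// ?addr_ge0 ?divr_ge0 ?cabs_ge0// ltW.
- have : cabs (zv + B * wv) <= 4 * d + K * (b * (ln b - ln a) + 2 * c).
    apply: le_trans (cabsD _ _) _; apply: lerD => //.
    by rewrite cabsM; apply: ler_pM => //; exact: cabs_ge0.
  move: (cabs _) (cabs_ge0 (zv + B * wv)) => w w0 wle2.
  rewrite !exprMn !sqr_sqrtr ?expR_ge0 ?mulr_ge0 ?expR_ge0//.
  rewrite [leRHS]mulrA [expR (- t) * (2 * _)]mulrCA.
  apply: ler_pM.
  + by rewrite mulr_ge0 ?mulr_ge0 ?expR_ge0.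
  + exact: sqr_ge0.
  + rewrite ler_pM2l// ler_pM2l ?expR_gt0// ler_expR ler_wpM2l//.
    by rewrite expRK; case/andP: ls.
  by rewrite ler_sqr ?nnegrE// (le_trans w0).
Qed.

End QuotientMetric.

(** * The Green circle *)

Section GreenCircle.
Variables (R : realType) (k : nat) (mu : R).
Hypothesis k_ge2 : (2 <= k)%N.
Hypothesis mu_le2 : mu <= 2.
Local Notation l := (green_length R k).
Local Notation kap := (Num.sqrt (2 * (2 - mu))).
Local Notation proj := (@green_proj R k : R^o -> set R).
Local Notation F := (fun (_ v : R^o) => Num.sqrt (2 * (2 - mu) * v ^+ 2) : R).

Lemma green_length_gt0 : 0 < l.
Proof. by rewrite divr_gt0// ln_gt0// ltr1n. Qed.

Lemma green_proj_eq x y : proj x = proj y <-> exists n : int, y = x + n%:~R * l.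
Proof.
split=> [xy|[n ->]].
  have [n _ <-] : proj x y by rewrite xy; exists 0 => //; rewrite mul0r addr0.
  by exists n.
apply/seteqP; split=> _ [m _ <-].
- by exists (m - n) => //; rewrite intrB; ring.
- by exists (n + m) => //; rewrite intrD; ring.
Qed.

Lemma green_normE x v : F x v = kap * `|v|.
Proof. by rewrite [LHS]sqrtrM ?mulr_ge0 ?subr_ge0// sqrtr_sqr. Qed.

Lemma green_norm_ge0 x v : 0 <= F x v. Proof. exact: sqrtr_ge0. Qed.

Lemma green_norm_opp x v : F x (- v) = F x v. Proof.
by apply: etrans (green_normE x (- v)) _; rewrite normrN -(green_normE x v).
Qed.

Lemma green_norm_continuous (c : R -> R^o) : C1_piece [set: R^o] c ->
  {within `[0%R, 1%R], continuous (fun x : R => F (c x) (derive1 c x))}.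
Proof.
move=> [_ dcc _]; apply: continuous_subspaceT => x.
apply: (@continuous_cvg _ _ _ _ _ _ (@Num.sqrt R));
  first exact: sqrt_continuous.
rewrite expr2; under eq_fun do rewrite expr2.
by apply: cvgM; [exact: cvg_cst|apply: cvgM; exact: dcc].
Qed.

Lemma affine_C1 (x v : R) : C1_piece [set: R^o]
  (fun e : R => x + e * v : R^o) /\
  derive1 (fun e : R => x + e * v : R^o) = fun=> v.
Proof.
apply: C1_pieceP => // [e|]; last by move=> ?; exact: cvg_cst.
rewrite -[X in is_derive _ _ _ X]add0r; apply: is_deriveD.
by apply: is_derive_eq; rewrite scaler0 add0r [_ *: _]mulr1.
Qed.

Lemma green_path (x y : R^o) : [set: R^o] x -> [set: R^o] y ->
  exists cs, path_from_to [set: R^o] cs x y.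
Proof.
move=> _ _; exists [:: fun e : R => x + e * (y - x)]; split.
- exact: (affine_C1 x (y - x)).1.
- by rewrite mul0r addr0.
- by split => //; rewrite mul1r addrC subrK.
Qed.

Lemma green_lift (x x' : R^o) : [set: R^o] x -> [set: R^o]
  x' -> proj x = proj x' ->
  exists g : R^o -> R^o, [/\ g x = x',
    forall y, [set: R^o] y -> [set: R^o] (g y) /\ proj (g y) = proj y
    & forall c, C1_piece [set: R^o] c -> C1_piece [set: R^o] (g \o c) /\
      forall t, 0 <= t <= 1 ->
        F (g (c t)) (derive1 (g \o c) t) = F (c t) (derive1 c t)].
Proof.
move=> _ _ /green_proj_eq[n ->]; exists (fun y => y + n%:~R * l); split.
- by [].
- by move=> y _; split; [exact: I|apply/esym/green_proj_eq; exists n].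
move=> c C1c; have [_ dcc _] := C1c.
have gcE (t : R) : is_derive t (1 : R) (fun t =>
  c t + n%:~R * l : R^o) (derive1 c t).
  rewrite -[X in is_derive _ _ _ X]addr0; apply: is_deriveD.
  exact: (@curve_is_derive _ _ _ _ t C1c).
have [C1gc dgc] := C1_pieceP (U := [set: R^o]) gcE dcc (fun _ _ => I).
split; first exact: C1gc.
by move=> t _; rewrite [X in X ^+ 2](congr1 (fun f => f t) dgc).
Qed.

Lemma green_dist_le x y (n : int) :
  green_dist k mu (green_proj k x) (green_proj k y) <= kap * `|y - x + n%:~R *
    l|.
Proof.
have -> : green_proj k y = green_proj k (y + n%:~R * l).
  by apply/green_proj_eq; exists n.
have [C1c cE] := affine_C1 x (y - x + n%:~R * l).
have := @length_dist_segment _ _ _ _ proj _ green_norm_ge0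
  green_norm_continuous _
  (kap * `|y - x + n%:~R * l|) C1c.
rewrite mul0r mul1r addr0 (_ : x + _ = y + n%:~R * l); last by ring.
by apply=> t _; rewrite cE green_normE.
Qed.

(** Calibration by [kap * x]; the integer [n] accounts for the free choice of lifts of both
    endpoints. *)
Lemma green_dist_ge x y m : (forall n : int, m <= kap * `|y - x + n%:~R * l|) ->
  m <= green_dist k mu (green_proj k x) (green_proj k y).
Proof.
move=> mle; have [cs pcs] := @green_path x y I I.
apply: (length_dist_ge (q := proj) pcs) => cs' x' y' pcs'.
move=> qx' qy'; have [n x'E] := (green_proj_eq _ _).1 (esym qx').
have [n' y'E] := (green_proj_eq _ _).1 (esym qy').
apply: le_trans (mle (n' - n)) _.
have -> : y - x + (n' - n)%:~R * l = y' - x'.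
  by rewrite x'E y'E intrB; ring.
rewrite -[kap]ger0_norm ?sqrtr_ge0// -normrM mulrBr.
apply: (path_length_ge (L := fun x : R^o => kap * x)
  (dL := fun _ v => kap * v) green_norm_continuous _ _ pcs').
- move=> c C1c; have [_ dcc _] := C1c; split.
    apply: continuous_subspaceT => e.
    by apply: cvgM; [exact: cvg_cst|exact: dcc].
  by move=> e _; exact: (is_deriveZ kap (@curve_is_derive _ _ _ _ e C1c)).
- move=> z v _; rewrite (green_normE z v).
  have alg (u : R) : `|kap * u| <= kap * `|u| by rewrite normrM ger0_norm
    ?sqrtr_ge0.
  exact: alg.
Qed.

Lemma green_dist_pseudometric : pseudometric_on (@green_circle R k) (green_dist
  k mu).
Proof.
split=> [_ [x _ <-]|_ _ [x _ <-] [y _ <-]|_ _ _ [x _ <-] [y _ <-] [z _ <-]].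
- exact: (@length_dist_xx _ _ _ _ proj _ green_norm_ge0 x).
- exact: (@length_dist_sym _ _ _ _ proj _ green_norm_ge0 green_norm_continuous
    green_norm_opp green_path x y).
- exact: (@length_dist_triangle _ _ _ _ proj _ green_norm_ge0 green_path
    green_lift x y z).
Qed.

(** A uniform range for the minimiser [j] is what allows finitely many iterates of [G], hence
    constants independent of the points, in the upper bound of [d_t]. *)
Lemma nearest_period (d : R) : `|d| <= l -> exists j : int,
  -1 <= j <= 1 /\ forall n : int, `|d + j%:~R * l| <= `|d + n%:~R * l|.
Proof.
have l0 := green_length_gt0; rewrite ler_norml => /andP[dl ld].
have nl (n : int) : (0 <= n -> 0 <= n%:~R * l) /\ (1 <= n -> l <= n%:~R * l).
  split=> n0; first by rewrite mulr_ge0 ?ler0z// ltW.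
  by rewrite ler_peMl ?ler1z// ltW.
have nl' (n : int) : (n <= 0 -> n%:~R * l <= 0) /\ (n <= -1 ->
  n%:~R * l <= - l).
  have := nl (- n); rewrite oppr_ge0 lerNr => -[h1 h2]; split=> n0.
    by have := h1 n0; rewrite intrN mulNr oppr_ge0.
  by have := h2 n0; rewrite intrN mulNr lerNr.
have [dle|dgt] := lerP d (l / 2); last first.
  exists (-1); split=> // n; rewrite mulN1r ler0_norm ?subr_le0//.
  have [n0|n0] := lerP 0 n.
    by have h := (nl n).1 n0; rewrite ger0_norm; lra.
  have n1 : n <= -1 by rewrite -ltzD1 addNr.
  by have h := (nl' n).2 n1; rewrite ler0_norm; lra.
have [dge|dlt] := lerP (- (l / 2)) d; last first.
  exists 1; split=> // n; rewrite mul1r ger0_norm; last by lra.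
  have [n0|n0] := lerP n 0.
    by have h := (nl' n).1 n0; rewrite ler0_norm; lra.
  by have h := (nl n).2 n0; rewrite ger0_norm; lra.
exists 0; split=> // n; rewrite mul0r addr0.
have [->|] := eqVneq n 0; first by rewrite mul0r addr0.
rewrite neq_lt => /orP[n0|n0].
  have n1 : n <= -1 by rewrite -ltzD1 addNr.
  have := (nl' n).2 n1 => h; rewrite (ler0_norm (x := d + _)); last by lra.
  by rewrite ler_norml; lra.
have := (nl n).2 n0 => h; rewrite (ger0_norm (x := d + _)); last by lra.
by rewrite ler_norml; lra.
Qed.

End GreenCircle.

(** * Green blocks *)

Lemma compact_fun_bounded (R : realType) (T : topologicalType) (A : set T) (f :
  T -> R) :
  compact A -> {within A, continuous f} ->
  exists2 K, 0 <= K & forall x, A x -> f x <= K.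
Proof.
move=> cA cf; have [->|/set0P A0] := eqVneq A set0; first by exists 0.
have [x Ax fx] := compact_EVT_max A0 cA cf.
exists (Num.max 0 (f x)) => [|y Ay]; first by rewrite le_max lexx.
by rewrite le_max fx ?orbT// inE.
Qed.

Lemma real_box_compact (R : realType) (a b c d : R) : compact (real_box a b c
  d).
Proof.
have -> : real_box a b c d =
    (`[- b, - a] `*` `[- c, c]) `*` (`[- d, d] `*` `[- d, d]) :> set (R4 R).
  apply/seteqP; split=> x /=; rewrite !in_itv/= -!ler_norml.
    by move=> [/andP[? ?] ? ? ?]; rewrite lerNl lerNr; split; split=> //;
      apply/andP; split.
  move=> [[/andP[xb xa] ?] [? ?]]; split=> //.
  by apply/andP; split; [rewrite lerNr|rewrite lerNl].
by apply: compact_setX; apply: compact_setX; exact: segment_compact.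
Qed.

Lemma Re_natM (R : realType) n (z : R[i]) : Re (n%:R * z) = n%:R * Re z.
Proof.
have -> : n%:R = (n%:R)%:C :> R[i] by rewrite rmorph_nat.
by case: z => x y; rewrite /= mul0r subr0.
Qed.

Lemma Im_natM (R : realType) n (z : R[i]) : Im (n%:R * z) = n%:R * Im z.
Proof.
have -> : n%:R = (n%:R)%:C :> R[i] by rewrite rmorph_nat.
by case: z => x y; rewrite /= mul0r addr0.
Qed.

(** Centring at [N.+1] leaves room for [j = -1]: the shift is realised by at least [N] forward
    iterations, so [s] stays above [k ^ N * s0]. *)
Lemma shift_exponent (N : nat) (j : int) : -1 <= j -> j <= 1 ->
  exists2 e, (N <= e <= N.+2)%N & e%:Z = N.+1%:Z + j.
Proof. by move=> ? ?; exists (absz (N.+1%:Z + j)); lia. Qed.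

Section GreenBlock.
Variable R : realType.
Local Notation C := R[i].
Variables (S : Type) (k r : nat) (lam : C) (Q : {poly C}) (q : C2 R -> S).
Variables (chi : C2 R -> R) (Theta : C2 R -> {linear C2 R -> R[i]^o}).
Variables (M s0 rad : R).
Local Notation Gam := (deck_group k r lam Q).
Local Notation mu := (mu_of k lam).
Hypotheses (k_ge2 : (2 <= k)%N) (lam_neq0 : lam != 0).
Hypothesis chiP : invariant_partition Gam chi.
Hypothesis ThetaP : is_Theta Gam chi Theta.
Hypothesis q_eq : forall p p', Xcov p -> Xcov p' ->
  q p = q p' <-> exists2 g, Gam g & p' = g p.
Hypotheses (mu_gt0 : 0 < mu) (mu_lt2 : mu < 2) (M_gt0 : 0 < M).
Hypotheses (s0_gt0 : 0 < s0) (rad_gt0 : 0 < rad).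
Local Notation l := (green_length R k).
Local Notation G := (deck_G k lam Q).

Definition block_lift : set (C2 R) :=
  [set p | [/\ s0 <= s_of p <= k%:R * s0, 0 <= theta_of p <= 2 * pi
             & cabs p.2 <= rad]].

Lemma k_gt0 : 0 < k%:R :> R.
Proof. by rewrite ltr0n (leq_trans _ k_ge2). Qed.

Lemma block_s_gt0 p : block_lift p -> 0 < s_of p.
Proof. by move=> [/andP[sp _] _ _]; exact: lt_le_trans sp. Qed.

Lemma block_Xcov p : block_lift p -> Xcov p.
Proof. by move=> /block_s_gt0; rewrite /s_of oppr_gt0. Qed.

Lemma block_box p : block_lift p ->
  real_box s0 (k%:R * s0) (2 * pi) rad (rpoint p).
Proof.
move=> [ss th z]; split=> //.
- by rewrite /= ger0_norm; case/andP: th.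
- exact: le_trans (normr_Re_le _) z.
- exact: le_trans (normr_Im_le _) z.
Qed.

Lemma Gam_G : Gam G.
Proof. by apply: generated_gen; apply: Or32. Qed.

Lemma Gam_iter_G n : Gam (iter n G).
Proof.
elim: n => [|n IH]; first exact: generated_id.
exact: generated_comp Gam_G IH.
Qed.

(** Natural multiples iterate [deck_T], negative ones are inverses of these. They bring the angles
    of two points within [2 * pi] of each other without changing [s]. *)
Lemma Gam_translation (m : int) :
  Gam (fun p : C2 R => (p.1 + 0 +i* (2 * pi * m%:~R), p.2)).
Proof.
have nat_case n : Gam (fun p : C2 R => (p.1 + 0 +i* (2 * pi * n%:R), p.2)).
  elim: n => [|n IH].
    rewrite (_ : (fun p => _) = id); first exact: generated_id.
    by apply/funext => -[w z] /=; rewrite mulr0 -[_ +i* _]/(0 : C) addr0.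
  have GT : Gam (@deck_T R) by apply: generated_gen; apply: Or31.
  have := generated_comp GT IH; congr generated.
  apply/funext => -[w z]; rewrite /deck_T /=; congr pair.
  have nE : 2 * pi * n.+1%:R = 2 * pi * n%:R + 2 * pi :> R.
    by rewrite (mulrSr 1 n); ring.
  by rewrite nE -addrA; congr (_ + _); apply/eqP;
    rewrite eq_complex/= addr0 !eqxx.
case: m => n; first exact: nat_case.
apply: generated_inv (nat_case n.+1) _ _ => -[w z] /=; congr pair;
  rewrite -addrA -[RHS]addr0; congr (_ + _); apply/eqP;
  by rewrite eq_complex/= addr0 NegzE intrN mulrN ?subrr ?addNr eqxx.
Qed.

Lemma q_Gam g p : Gam g -> Xcov p -> Xcov (g p) /\ q (g p) = q p.
Proof.
move=> Gg Xp; have [a [b [m [h [dh gD]]]]] := deck_group_form k_ge2 lam_neq0 Gg.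
have Xgp := deck_Xcov gD Xp; split=> //; apply/esym/q_eq => //.
by exists g.
Qed.

Lemma s_of_iter_G n p : s_of (iter n G p) = k%:R ^+ n * s_of p.
Proof.
elim: n => [|n IH]; first by rewrite mul1r.
by rewrite exprS -mulrA -IH /s_of mulrN -Re_natM.
Qed.

Lemma theta_of_iter_G n p : theta_of (iter n G p) = k%:R ^+ n * theta_of p.
Proof.
elim: n => [|n IH]; first by rewrite mul1r.
by rewrite exprS -mulrA -IH /theta_of -Im_natM.
Qed.

(** The bound may grow very fast with [n], since [h] is a polynomial in [exp (- w)] and [s] grows
    under [G]. It only enters terms that carry the factor [e^(-t/2)]. *)
Lemma iter_G_bounded (A : set (R4 R)) n : compact A -> exists2 d, 0 <= d &
  forall e x, (e <= n)%N -> A x -> cabs (iter e G (Defs.cpoint x)).2 <= d.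
Proof.
move=> cA; have bound e : exists2 d, 0 <= d &
    forall x, A x -> cabs (iter e G (Defs.cpoint x)).2 <= d.
  apply: compact_fun_bounded => //; apply: continuous_subspaceT => x.
  have [a [b [m [h [dh gD]]]]] := deck_group_form k_ge2 lam_neq0 (Gam_iter_G e).
  apply: (@cvg_cabs _ _ _ _ (fun x => (iter e G (Defs.cpoint x)).2)); split.
  apply: (@continuous_comp (R4 R) (C2 R) C^o (fun x =>
    iter e G (Defs.cpoint x)) snd).
    apply: continuous_comp; first exact: cpoint_continuous.
    exact: deck_continuous gD.
  exact: cvg_snd.
elim: n => [|n [d d0 IH]].
  by have [d d0 Ad] := bound 0%N; exists d => // e x; rewrite leqn0 => /eqP ->;
    exact: Ad.
have [d' d'0 Ad'] := bound n.+1.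
exists (d + d'); first exact: addr_ge0.
move=> e x; rewrite leq_eqVlt => /orP[/eqP ->|en] Ax.
  by apply: le_trans (Ad' _ Ax) _; rewrite lerDr.
by apply: le_trans (IH e x en Ax) _; rewrite lerDl.
Qed.

Lemma Bcoef_bounded a b c d : 0 < a -> exists2 K, 0 <= K & forall z,
  real_box a b c d z -> cabs (Bcoef k r lam Q chi (Defs.cpoint z)) <= K.
Proof.
move=> a0; apply: compact_fun_bounded; first exact: real_box_compact.
apply: continuous_in_subspaceT => x; rewrite inE => -[/andP[ax _] _ _ _].
have Ux : Xcov (Defs.cpoint x) by rewrite /Xcov /= -oppr_gt0;
  exact: lt_le_trans ax.
apply: (@cvg_cabs _ _ _ _ (fun x => Bcoef k r lam Q chi (Defs.cpoint x)));
  split.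
apply: (@continuous_comp (R4 R) (C2 R) C^o (@Defs.cpoint R) (Bcoef k r lam Q
  chi)).
  exact: cpoint_continuous.
by have [] := Bcoef_continuous k_ge2 lam_neq0 chiP Ux.
Qed.

(** Difference of the Green coordinates [rho] of two lifts; changing the lifts adds a multiple of
    the period. *)
Definition log_gap (p p' : C2 R) : R := ln (s_of p') / 2 - ln (s_of p) / 2.

(* Multiplying [w] by a large power of [k] makes the period [2 * pi] of [Im w]
   as short as one likes, so that the [theta]-direction collapses. *)
Lemma dist_t_block_le N : exists2 K, 0 <= K & forall t (j : int) p p',
  0 <= A_of mu M t -> -1 <= j <= 1 -> block_lift p -> block_lift p' ->
  dist_t q mu M Theta t (q p) (q p') <= Num.sqrt (A_of mu M t / 2) *
      (2 * `|log_gap p p' + j%:~R * l| + 2 * pi / (k%:R ^+ N * s0)) +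
    Num.sqrt (expR (- t)) * K.
Proof.
have [d d0 dP] := iter_G_bounded N.+2 (@real_box_compact R s0 (k%:R * s0) (2 *
  pi) rad).
(* [a] and [b] enclose [s] on the iterates [N] to [N.+2] of the block; [c] exceeds the largest angle
   by one turn, to allow for the final translation. *)
pose a := k%:R ^+ N * s0; pose b := k%:R ^+ N.+2 * (k%:R * s0).
pose c := k%:R ^+ N.+2 * (2 * pi) + 2 * pi : R.
have kpow (e : nat) : 0 < k%:R ^+ e :> R by rewrite exprn_gt0// k_gt0.
have a0 : 0 < a by rewrite mulr_gt0.
have pi2 : 0 < 2 * pi :> R by rewrite mulr_gt0// pi_gt0.
have [K K0 KP] := Bcoef_bounded b c d a0.
have kpow_le (e e' : nat) : (e <= e')%N -> k%:R ^+ e <= k%:R ^+ e' :> R.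
  by move=> ee'; rewrite ler_weXn2l// ler1n (leq_trans _ k_ge2).
have kp0 : 0 < k%:R * s0 by rewrite mulr_gt0// k_gt0.
have ab : a <= b.
  apply: ler_pM; [exact: ltW|exact: ltW|by apply: kpow_le; rewrite leqW|].
  by rewrite ler_peMl ?(ltW s0_gt0)// ler1n (leq_trans _ k_ge2).
have sE e p : (N <= e <= N.+2)%N -> block_lift p -> a <= s_of (iter e G p) <= b.
  move=> /andP[Ne eN] Bp; have [/andP[sp ps] _ _] := Bp; rewrite s_of_iter_G.
  have sp0 := ltW (block_s_gt0 Bp).
  apply/andP; split.
    exact: (ler_pM (ltW (kpow N)) (ltW s0_gt0) (kpow_le _ _ Ne) sp).
  exact: (ler_pM (ltW (kpow e)) sp0 (kpow_le _ _ eN) ps).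
have lnsE e p : block_lift p ->
  ln (s_of (iter e G p)) = e%:R * ln k%:R + ln (s_of p).
  move=> /block_s_gt0 sp; rewrite s_of_iter_G lnM ?posrE// lnXn ?k_gt0//.
  by rewrite mulr_natl.
have thE e p : (e <= N.+2)%N -> block_lift p ->
    0 <= theta_of (iter e G p) <= k%:R ^+ N.+2 * (2 * pi).
  move=> eN [_ /andP[th0 th1] _]; rewrite theta_of_iter_G.
  rewrite (mulr_ge0 (ltW (kpow e)) th0) /=.
  exact: (ler_pM (ltW (kpow e)) th0 (kpow_le _ _ eN) th1).
have zE e p : (e <= N.+2)%N -> block_lift p -> cabs (iter e G p).2 <= d.
  by move=> eN /block_box Bp; rewrite -[p]rpointK; exact: dP.
exists (Num.sqrt (2 * expR (mu * ln b)) * (4 * d + K * (b * (ln b - ln a) + 2 *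
  c))).
  have lab : ln a <= ln b by rewrite ler_ln ?posrE// (lt_le_trans a0).
  have b0 : 0 <= b by exact: le_trans (ltW a0) ab.
  have c0 : 0 <= c by rewrite addr_ge0 ?(ltW pi2)// mulr_ge0 ?(ltW pi2)// ltW.
  apply: mulr_ge0; first exact: sqrtr_ge0.
  apply: addr_ge0; first by rewrite mulr_ge0.
  apply: mulr_ge0 => //; apply: addr_ge0; last by rewrite mulr_ge0.
  by rewrite mulr_ge0// subr_ge0.
move=> t j p p' A0 /andP[j1 j2] Bp Bp'.
have [e' eN' e'E] := shift_exponent N j1 j2.
set P := iter N.+1 G p; pose P1 := iter e' G p'.
(* The number of turns that brings the angle of [P1] within [2 * pi] of that of [P]. *)
pose m := Num.floor ((theta_of P - theta_of P1) / (2 * pi)).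
pose P' : C2 R := (P1.1 + 0 +i* (2 * pi * m%:~R), P1.2).
have [XP qP] := q_Gam (Gam_iter_G N.+1) (block_Xcov Bp).
have [XP1 qP1] := q_Gam (Gam_iter_G e') (block_Xcov Bp').
have [XP' qP'] := q_Gam (Gam_translation m) XP1.
have sP' : s_of P' = s_of P1.
  by rewrite /P' /s_of /=; case: (P1.1) => x y /=; rewrite addr0.
have thP' : theta_of P' = theta_of P1 + 2 * pi * m%:~R.
  by rewrite /P' /theta_of /=; case: (P1.1).
have N1 : (N <= N.+1 <= N.+2)%N by rewrite !leqnSn.
have N12 : (N.+1 <= N.+2)%N by [].
have e'2 : (e' <= N.+2)%N by case/andP: eN'.
have /andP[m1 m2] := floor_itv ((theta_of P - theta_of P1) / (2 * pi)).
have dth : `|theta_of P' - theta_of P| <= 2 * pi.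
  move: m1 m2; rewrite -/m ler_pdivlMr// ltr_pdivrMr// intrD mulrDl mul1r thP'.
  by rewrite ler_norml [2 * pi * _]mulrC => ? ?; lra.
have thP := thE _ _ N12 Bp; have thP1 := thE _ _ e'2 Bp'.
have boxP : real_box a b c d (rpoint P).
  have zP := zE _ _ N12 Bp; split.
  - exact: sE.
  - rewrite -[(rpoint P).1.2]/(theta_of P) /c.
    by case/andP: thP => h1 h2; rewrite ger0_norm//; lra.
  - exact: le_trans (normr_Re_le _) zP.
  - exact: le_trans (normr_Im_le _) zP.
have boxP' : real_box a b c d (rpoint P').
  have zP := zE _ _ e'2 Bp'; split.
  - by rewrite -[- _]/(s_of P') sP'; exact: sE.
  - rewrite -[(rpoint P').1.2]/(theta_of P') /c.
    move: dth thP; rewrite !ler_norml => /andP[? ?] /andP[? ?].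
    by apply/andP; split; lra.
  - exact: le_trans (normr_Re_le _) zP.
  - exact: le_trans (normr_Im_le _) zP.
have := dist_t_le q k_ge2 lam_neq0 chiP ThetaP A0 a0 (ltW mu_gt0) K0 KP boxP
  boxP'.
rewrite /= !rpointK qP' -/P1 qP1 qP => /le_trans; apply.
rewrite lerD2r ler_wpM2l ?sqrtr_ge0//; apply: lerD.
  (* The exponents [e'] and [N.+1] differ by [j], and the period is [ln k / 2], so the gap of [ln s]
     is exactly twice the shifted [log_gap]. *)
  rewrite -[- _]/(s_of P') -[- complex.Re P.1]/(s_of P) sP' !lnsE//.
  have -> : 2 * `|log_gap p p' + j%:~R * l| = `|2 * (log_gap p p' + j%:~R * l)|.
    by rewrite normrM normr_nat.
  rewrite le_eqVlt; apply/orP; left; apply/eqP.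
  have : e'%:R = N.+1%:R + j%:~R :> R by rewrite -[LHS]/(e'%:Z%:~R) e'E intrD.
  by rewrite /log_gap /green_length => ->; congr `|_|; field.
by rewrite ler_wpM2r// invr_ge0 ltW.
Qed.

Lemma same_fibre_log p p' : Xcov p -> Xcov p' -> q p = q p' ->
  exists n : int, ln (s_of p') = ln (s_of p) + n%:~R * ln k%:R.
Proof.
move=> Xp Xp' /(q_eq Xp Xp')[g /(deck_group_form k_ge2 lam_neq0) gD ->].
have [a [b [m [h [dh gDF]]]]] := gD; have [n na] := deck_a_pow gDF.
have sp : 0 < s_of p by rewrite /s_of oppr_gt0.
by exists n; rewrite (deck_s_of gDF) lnM ?posrE ?(deck_a_gt0 gDF)// na addrC.
Qed.

(** Replacing the lifts at the ends of a path adds a multiple of the period to [log_gap], and [j] is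
    a minimising shift, so the calibration bound holds for every path. *)
Lemma dist_t_block_ge t (j : int) p p' : 0 <= A_of mu M t ->
  block_lift p -> block_lift p' ->
  (forall n : int, `|log_gap p p' + j%:~R * l| <= `|log_gap p p' + n%:~R * l|)
    ->
  Num.sqrt (A_of mu M t / 2) * (2 * `|log_gap p p' + j%:~R * l|) <=
  dist_t q mu M Theta t (q p) (q p').
Proof.
move=> A0 /block_Xcov Xp /block_Xcov Xp' jmin.
have Ux : Xcov (Defs.cpoint (rpoint p)) by rewrite rpointK.
have Uy : Xcov (Defs.cpoint (rpoint p')) by rewrite rpointK.
rewrite -[p in leRHS]rpointK -[p' in leRHS]rpointK.
apply: (dist_t_ge k_ge2 lam_neq0 chiP ThetaP A0 Ux Uy) =>
  x' y' Ux' Uy' /= qx qy.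
have [n nE] := same_fibre_log Ux' Ux qx;
  have [n' n'E] := same_fibre_log Uy' Uy qy.
rewrite ler_wpM2l ?sqrtr_ge0//.
have -> : ln (- y'.1.1) - ln (- x'.1.1) = 2 * (log_gap p p' + (n - n')%:~R * l).
  rewrite !rpointK in nE n'E; rewrite /log_gap nE n'E intrB /green_length.
  by rewrite /s_of /=; field.
by rewrite normrM normr_nat ler_wpM2l.
Qed.

(* Independent of the lift, as deck transformations multiply [s] by powers of
   [k]. *)
Definition green_map (y : S) : set R :=
  green_proj k (ln (s_of (xget (0 : C2 R) [set p | Xcov p /\ q p = y])) / 2).

Lemma green_mapE p : Xcov p -> green_map (q p) = green_proj k (ln (s_of p) / 2).
Proof.
move=> Xp; rewrite /green_map.
have [] : [set p' | Xcov p' /\ q p' = q p]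
  (xget (0 : C2 R) [set p' | Xcov p' /\ q p' = q p]).
  by apply: xgetI; exact: (conj Xp erefl).
set p' := xget _ _ => Xp' qp'; have [n ->] := same_fibre_log Xp' Xp qp'.
by apply/green_proj_eq; exists n; rewrite /green_length; ring.
Qed.

(** The values of [log s / 2] on the block fill an interval of length exactly one period, so
    reduction by a floor reaches every coset; [theta = 0] and [z = 0] complete the point. *)
Lemma green_map_block_surj rho : exists2 p, block_lift p &
  green_proj k (ln (s_of p) / 2) = green_proj k rho.
Proof.
have l0 := @green_length_gt0 R k k_ge2.
pose n := Num.floor ((rho - ln s0 / 2) / l); pose rho' := rho - n%:~R * l.
have /andP[n1 n2] := floor_itv ((rho - ln s0 / 2) / l).
have rho'E : ln s0 / 2 <= rho' <= ln s0 / 2 + l.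
  move: n1 n2; rewrite -/n ler_pdivlMr// ltr_pdivrMr// intrD mulrDl mul1r /rho'.
  by move=> ? ?; apply/andP; split; lra.
exists (((- expR (2 * rho')) +i* 0, 0) : C2 R); last first.
  rewrite /s_of /= opprK expRK; apply/green_proj_eq; exists n.
  by rewrite /rho'; field.
split.
- have s0E : s0 = expR (ln s0) by rewrite lnK.
  have ks0E : k%:R * s0 = expR (ln k%:R + ln s0) by rewrite expRD !lnK ?posrE
    ?k_gt0.
  rewrite /s_of /= opprK ks0E {1}s0E !ler_expR.
  by move: rho'E; rewrite /green_length => /andP[? ?]; apply/andP; split; lra.
- by rewrite /theta_of /= lexx mulr_ge0// pi_ge0.
- have -> : cabs ((- expR (2 * rho') +i* 0,
  0) : C2 R).2 = 0 by exact: Normc.normc0.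
  exact: ltW.
Qed.

Lemma log_gap_le p p' : block_lift p -> block_lift p' -> `|log_gap p p'| <= l.
Proof.
have bound p0 : block_lift p0 -> ln s0 <= ln (s_of p0) <= ln k%:R + ln s0.
  move=> Bp; have [/andP[h1 h2] _ _] := Bp; have h0 := block_s_gt0 Bp.
  rewrite -lnM ?posrE ?k_gt0// !ler_ln ?posrE ?mulr_gt0 ?k_gt0//.
  by rewrite h1.
move=> /bound/andP[? ?] /bound/andP[? ?];
  rewrite ler_norml /log_gap /green_length.
by apply/andP; split; lra.
Qed.

Local Notation kap := (Num.sqrt (2 * (2 - mu))).

Lemma green_dist_block (j : int) p p' :
  (forall n : int, `|log_gap p p' + j%:~R * l| <= `|log_gap p p' + n%:~R * l|)
    ->
  green_dist k mu (green_proj k (ln (s_of p) / 2)) (green_proj k (ln (s_of p')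
    / 2)) =
  kap * `|log_gap p p' + j%:~R * l|.
Proof.
move=> jmin; have mu2 := ltW mu_lt2; apply/eqP; rewrite eq_le; apply/andP;
  split.
  exact: green_dist_le.
by apply: green_dist_ge => // n; rewrite ler_wpM2l ?sqrtr_ge0//; exact: jmin.
Qed.

(** [A(t)] is the convex combination of [2 - mu] and [M] with weights [1 - e^(-t)] and [e^(-t)]. *)
Lemma A_of_bounds t : 0 <= t -> 0 <= A_of mu M t <= 2 - mu + M.
Proof.
move=> t0; have e1 : expR (- t) <= 1 by rewrite -expR0 ler_expR oppr_le0.
have e0 := expR_gt0 (- t); rewrite /A_of.
have h1 : 0 <= (1 - expR (- t)) * (2 - mu).
  by rewrite mulr_ge0 ?subr_ge0// ltW.
have h2 : 0 < expR (- t) * M by rewrite mulr_gt0.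
have h3 : 0 <= (1 - expR (- t)) * M by rewrite mulr_ge0 ?subr_ge0// ltW.
have h4 : 0 <= expR (- t) * (2 - mu) by rewrite mulr_ge0 ?expR_ge0// subr_ge0
  ltW.
by apply/andP; split; lra.
Qed.

Lemma A_of_cvg : A_of mu M t @[t --> +oo] --> (2 - mu : R^o).
Proof.
rewrite -[X in _ --> (X : R^o)]addr0 -[X in _ + X](mul0r (M - (2 - mu))).
apply: (@cvgD R R^o); first exact: cvg_cst.
by apply: cvgM; [exact: cvgr_expR|exact: cvg_cst].
Qed.

(** One [e] bounds the additive error in [d_t], made of [e / 2] for the theta-circle and [e / 2] for
    the part of [Theta]. The other bounds the effect of replacing the speed [al t] by [c * kap] over
    a distance at most one period. *)
Lemma GH_dist_block_le e : 0 < e -> \forall t \near +oo,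
  (GH_dist (green_block q k s0 rad) (dist_t q mu M Theta t)
     (@green_circle R k) (@green_dist R k mu) <= (2 * e)%:E)%E.
Proof.
move=> e0; have l0 := @green_length_gt0 R k k_ge2; have mu2 := ltW mu_lt2.
have kap0 : 0 < kap by rewrite sqrtr_gt0 mulr_gt0// subr_gt0.
(* A bound of the transverse factor for all [t >= 0], so that [N] can be fixed before [t]. *)
pose Amax := Num.sqrt ((2 - mu + M) / 2).
have Amax0 : 0 <= Amax := sqrtr_ge0 _.
have pi2 : 0 < 2 * pi :> R by rewrite mulr_gt0// pi_gt0.
have [N NP] : exists N : nat, Amax * (2 * pi / (k%:R ^+ N * s0)) <= e / 2.
  (* The inequality amounts to [X <= k ^ N]; since [n < k ^ n], the Archimedean bound of [X] is a
     sufficient exponent. *)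
  pose X := Amax * (2 * pi) / s0 / (e / 2).
  exists (Num.bound X).
  have kN : X <= k%:R ^+ Num.bound X.
    have X0 : 0 <= X.
      apply: divr_ge0; last by rewrite divr_ge0// ltW.
      by apply: divr_ge0; [apply: mulr_ge0 => //; exact: ltW|exact: ltW].
    apply: le_trans (ltW (archi_boundP X0)) _.
    by rewrite -natrX ler_nat ltnW// ltn_expl.
  have kp : 0 < k%:R ^+ Num.bound X :> R by rewrite exprn_gt0// k_gt0.
  rewrite mulrA ler_pdivrMr ?mulr_gt0//.
  move: kN; rewrite /X ler_pdivrMr ?divr_gt0// ler_pdivrMr//.
  by rewrite mulrCA mulrAC [e / 2 * _]mulrC.
have [K K0 KP] := dist_t_block_le N.
(* The transverse speed with respect to [rho]; the factor 2 is that of [d log s = 2 d rho], and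
   [2 * sqrt ((2 - mu) / 2)] is [kap]. *)
pose al t := 2 * Num.sqrt (A_of mu M t / 2).
have al_cvg : al t @[t --> +oo] --> (kap : R^o).
  have -> : kap = 2 * Num.sqrt ((2 - mu) / 2).
    have two : Num.sqrt (2 ^+ 2) = 2 :> R by rewrite sqrtr_sqr ger0_norm.
    rewrite -[X in X * Num.sqrt _]two -sqrtrM ?sqr_ge0//.
    by congr Num.sqrt; field.
  apply: cvgM; first exact: cvg_cst.
  apply: (@continuous_cvg _ _ _ _ _ _ (@Num.sqrt R));
    first exact: sqrt_continuous.
  by apply: cvgM; [exact: A_of_cvg|exact: cvg_cst].
have sqrt_exp_cvg : Num.sqrt (expR (- t)) * K @[t --> +oo] --> (0 : R^o).
  rewrite -[X in _ --> (X : R^o)](mul0r K) -[X in _ --> (X * _ : R^o)](@sqrtr0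
    R).
  apply: cvgM; last exact: cvg_cst.
  apply: (@continuous_cvg _ _ _ _ _ _ (@Num.sqrt R));
    first exact: sqrt_continuous.
  exact: cvgr_expR.
have e20 : 0 < e / 2 by rewrite divr_gt0.
have el0 : 0 < e / l by rewrite divr_gt0.
have al_dist : \forall t \near +oo, `|kap - al t| <= e / l.
  by move/(@cvgrPdist_le R R^o): al_cvg; exact.
have sqrt_exp_dist : \forall t \near +oo,
  `|0 - Num.sqrt (expR (- t)) * K| <= e / 2.
  by move/(@cvgrPdist_le R R^o): sqrt_exp_cvg; exact.
near=> t.
have t0 : 0 <= t by near: t; apply: nbhs_pinfty_ge; rewrite num_real.
have /andP[A0 Ale] := A_of_bounds t0.
have al_near : `|kap - al t| <= e / l.
  by near: t.
have exp_near : Num.sqrt (expR (- t)) * K <= e / 2.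
  apply: le_trans (ler_norm _) _; rewrite -normrN -sub0r.
  by near: t.
have al0 : 0 <= al t by rewrite mulr_ge0// sqrtr_ge0.
(* Chosen so that [c * kap = min kap (al t)]: this lies below both speeds, and within [|kap - al t|]
   of each of them. *)
pose c := Num.min 1 (al t / kap).
have ckap : c * kap = Num.min kap (al t).
  by rewrite /c minr_pMl ?ltW// mul1r divfK// gt_eqF.
have ckap_al : c * kap <= al t by rewrite ckap ge_min lexx orbT.
have gap_le u : 0 <= u <= l -> `|kap - al t| * u <= e.
  move=> /andP[u0 ul]; apply: le_trans (_ : e / l * l <= e);
    last by rewrite divfK ?gt_eqF.
  by apply: ler_pM.
have al_ckap : al t - c * kap <= `|kap - al t|.
  by rewrite ckap; have := ler_norm (al t - kap); rewrite distrC;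
    case: (lerP kap (al t)) => ?; lra.
have kap_ckap : kap - c * kap <= `|kap - al t|.
  by rewrite ckap; have := ler_norm (kap - al t); case: (lerP kap (al t)) => ?;
    lra.
(* [u] is the distance in [rho] between the nearest lifts; both distances are compared with it. *)
have cmp p p' : block_lift p -> block_lift p' -> exists u, [/\ 0 <= u <= l,
    green_dist k mu (green_proj k (ln (s_of p) / 2)) (green_proj k (ln (s_of
      p') / 2)) = kap * u
    & al t * u <= dist_t q mu M Theta t (q p) (q p') <= al t * u + e].
  move=> Bp Bp'; have gapl := log_gap_le Bp Bp'.
  have [j [j1 jmin]] := nearest_period k_ge2 gapl.
  exists `|log_gap p p' + j%:~R * l|; split.
  - by rewrite normr_ge0 (le_trans (jmin 0))// mul0r addr0.
  - exact: green_dist_block.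
  - rewrite /al [2 * _]mulrC -mulrA dist_t_block_ge//=.
    apply: le_trans (KP t j p p' A0 j1 Bp Bp') _.
    rewrite mulrDr -addrA lerD2l [leRHS]splitr; apply: lerD => //.
    apply: le_trans NP; rewrite ler_wpM2r//.
      by rewrite divr_ge0 ?ltW// mulr_gt0// exprn_gt0// k_gt0.
    by apply: ler_wsqrtr; rewrite ler_wpM2r.
have blk_Xcov := block_Xcov.
have [p0 Bp0 _] := green_map_block_surj 0.
apply: (@GH_dist_le _ _ _ _ _ _ _ green_map c).
- by exists (q p0), p0.
- have [dxx dsym dtri] := dist_t_pseudometric M t k_ge2 lam_neq0 chiP ThetaP
  q_eq.
  have sub x : green_block q k s0 rad x -> (q @` @Xcov R) x.
    by move=> [p Bp <-]; exists p => //; exact: blk_Xcov.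
  split=> [x /sub|x y /sub + /sub|x y z /sub + /sub + /sub].
  + exact: dxx.
  + exact: dsym.
  + exact: dtri.
- exact: green_dist_pseudometric.
- by move=> _ [p Bp <-]; rewrite green_mapE;
  [exists (ln (s_of p) / 2)|exact: blk_Xcov].
- move=> _ [rho _ <-]; have [p Bp <-] := green_map_block_surj rho.
  by exists (q p); [exists p|rewrite green_mapE//; exact: blk_Xcov].
- exact: e0.
- by rewrite le_min ler01 divr_ge0 ?(ltW kap0)//= ge_min lexx.
- move=> _ _ [p Bp <-] [p' Bp' <-].
  rewrite !green_mapE; [|exact: blk_Xcov..].
  have [u [u0l -> /andP[h1 h2]]] := cmp _ _ Bp Bp'.
  have := gap_le u u0l; have /andP[u0 ul] := u0l.
  rewrite mulrA => h3; apply/andP; split.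
    by apply: le_trans h1; rewrite ler_wpM2r.
  have := ler_wpM2r u0 al_ckap; rewrite mulrBl; lra.
- move=> _ _ [rho _ <-] [rho' _ <-].
  have [p Bp <-] := green_map_block_surj rho.
  have [p' Bp' <-] := green_map_block_surj rho'.
  have [u [u0l -> _]] := cmp _ _ Bp Bp'.
  have := gap_le u u0l; have /andP[u0 ul] := u0l.
  rewrite mulrA => h3; apply/andP; split; first exact: mulr_ge0 (ltW kap0) u0.
  have := ler_wpM2r u0 kap_ckap; rewrite mulrBl; lra.
Unshelve. all: by end_near. Qed.

End GreenBlock.

Theorem theorem5 (R : realType) (S : topologicalType) (At : set (chart R S))
    (k r : nat) (lam : R[i]) (Q : {poly R[i]}) (q : C2 R -> S)
    (chi : C2 R -> R) (Theta : C2 R -> {linear C2 R -> R[i]^o})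
    (M s0 rad : R) :
  kato_surface At ->
  intermediate_type At ->
  (2 <= k)%N -> (1 <= r)%N -> lam != 0 ->
  uniformizes At (rational_divisor At) (deck_group k r lam Q) q ->
  0 < mu_of k lam < 2 ->
  invariant_partition (deck_group k r lam Q) chi ->
  is_Theta (deck_group k r lam Q) chi Theta ->
  0 < M -> 0 < s0 -> 0 < rad ->
  (fun t : R => GH_dist (green_block q k s0 rad)
                        (dist_t q (mu_of k lam) M Theta t)
                        (@green_circle R k) (@green_dist R k (mu_of k lam)))
    @ +oo --> 0%E.
Proof.
move=> _ _ k_ge2 _ lam_neq0 [_ _ _ q_eq _] /andP[mu_gt0 mu_lt2] chiP ThetaP.
move=> M_gt0 s0_gt0 rad_gt0.
have GH_le e : 0 < e -> \forall t \near +oo, (GH_dist (green_block q k s0 rad)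
    (dist_t q (mu_of k lam) M Theta t)
    (@green_circle R k) (@green_dist R k (mu_of k lam)) <= (2 * e)%:E)%E.
  exact: (GH_dist_block_le k_ge2 lam_neq0 chiP ThetaP q_eq mu_gt0 mu_lt2 M_gt0
    s0_gt0 rad_gt0).
(* Convergence to 0 in the extended reals means eventual finiteness, given by the bound for [e = 1],
   and convergence of the real values. *)
apply/fine_cvgP; split.
  apply: filterS (GH_le 1 ltr01) => t GHt.
  by rewrite ge0_fin_numE ?GH_dist_ge0//; exact: le_lt_trans GHt (ltry _).
apply/(@cvgrPdist_le R R^o) => e e0.
have e20 : 0 < e / 2 by rewrite divr_gt0.
apply: filterS (GH_le _ e20) => t; rewrite mulrCA divff// mulr1 => GHt.
rewrite sub0r normrN /= ger0_norm ?fine_ge0 ?GH_dist_ge0//.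
rewrite -lee_fin fineK// ge0_fin_numE ?GH_dist_ge0//.
exact: le_lt_trans GHt (ltry _).
Qed.
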